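(* Fix $c\in(0,1)$. Consider the random two-layer network on $N$ peers with the Random Flow-Assignment (RFA) and the chunk-dissemination rule described in the context. There exist a constant $C>0$ and a sequence $\delta_N\to 0$ such that, with probability tending to $1$ as $N\to\infty$, at least $(1-\delta_N)N$ of the peers $v$ satisfy, for both flows $f\in\{1,2\}$: the directed distance from the source to $v$ in flow graph $F_f$ is at most $C\log N$, and hence every flow-$f$ chunk generated by the source in any time slot $t$ is received by $v$ by time slot $t+C\log N$ (so that $v$ receives the whole stream, which may have the maximum rate of $M=2$ chunks per time slot, with delay $O(\log N)$).
   Context: Network. Peers are $V=\{1,\dots,N\}$; peer $1$ is the source. There are $M=2$ layers $L_1,L_2$, independent and each uniformly distributed over the $N!$ 1-regular digraphs on $V$: $L_m$ has edges $(v,\sigma_m(v))$, $v\in V$, with $\sigma_1,\sigma_2$ independent uniformly random permutations of $V$ (loops allowed). The $m$-th child of $v$ is $c_m(v)=\sigma_m(v)$ and its $m$-th parent is $p_m(v)=\sigma_m^{-1}(v)$; the edge $(p_m(v),v)$ of $L_m$ is the $m$-th incoming edge of $v$. RFA. $\log$ is the natural logarithm, $d^*=\lceil\log_2(N/\log^c N)\rceil$. Let $\delta(v)$ be the directed distance from the source to $v$ in the union $L_1\cup L_2$. Put $d(v)=\delta(v)$ if $\delta(v)\le d^*$, else $d(v)=\infty$. Each $v\ne1$ assigns the two flows $1,2$ bijectively to its two incoming edges; $f_m(v)$ is the flow of its $m$-th incoming edge. If $1\le d(v)\le d^*$: choose $m^*(v)$ uniformly at random among the $m$ with $d(p_m(v))=d(v)-1$;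 set the main flow $\chi(v)=m^*(v)$ if $d(v)=1$ and $\chi(v)=\chi(p_{m^*(v)}(v))$ if $d(v)\ge2$; set $f_{m^*(v)}(v)=\chi(v)$ and give the other flow to the other incoming edge. If $d(v)=\infty$: $(f_1(v),f_2(v))$ is a uniformly random permutation of $(1,2)$. All these random choices are mutually independent and independent of the layers. Incoming edges of the source carry no flow. Flow graphs. $F_f$ is the digraph on $V$ whose edges are the incoming edges $(p_m(v),v)$ with $v\neq 1$ and $f_m(v)=f$. Dissemination. Time is slotted. In each slot the source generates at most one chunk of each flow. Each peer keeps an (initially empty) FIFO queue for each outgoing edge carrying a flow; when it generates or receives a flow-$f$ chunk, it adds the chunk to the queues of all its outgoing flow-$f$ edges. At the beginning of each slot each nonempty queue transmits its oldest chunk over its edge (one chunk per edge per slot); a chunk received in a slot can be transmitted from the next slot on. *)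

(* Defs.v *)
From HB Require Import structures.
From mathcomp Require Import all_boot all_order all_algebra all_fingroup.
From mathcomp Require Import all_classical all_reals all_analysis.
Set Implicit Arguments.
Unset Strict Implicit.
Unset Printing Implicit Defensive.
Import Order.TTheory GRing.Theory Num.Theory.
Import numFieldNormedType.Exports.

Section Distance.
Variables (T : finType) (e : rel T).

Definition walk (x y : T) (k : nat) : bool :=
  [exists p : k.-tuple T, path e x p && (last x p == y)].

(* Directed distance; [None] stands for an infinite distance. *)
Definition dist (x y : T) : option nat :=
  if pselect (exists k, walk x y k) is left h then Some (ex_minn h) else None.

End Distance.

Definition uniform_pr (R : realType) (T : finType) (A : {set T}) : R :=
  (#|A|%:R / #|T|%:R)%R.

(* The network has N = n.+1 peers, numbered from 0 instead of 1; layers and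
   flows are likewise numbered 0 and 1. *)
Definition peer (n : nat) := 'I_n.+1.
Definition layer := 'I_2.
Definition flow := 'I_2.

Definition source {n} : peer n := ord0.

(* A point (sigma, tie, pi) of the sample space consists of the layer
   permutations sigma, of a layer tie(v) for each peer v, used to choose between
   the two incoming edges of v when both are admissible, and of a permutation
   pi(v) of the flows for each peer v, used when d(v) is infinite. Under the
   uniform probability on this product all these components are independent
   and uniform. *)
Definition outcome (n : nat) : finType :=
  ({ffun layer -> {perm peer n}} * {ffun peer n -> layer} *
   {ffun peer n -> {perm flow}})%type.

Section Network.
Variables (R : realType) (c : R) (n : nat) (w : outcome n).

Definition sigma (m : layer) : {perm peer n} := w.1.1 m.
Definition tie (v : peer n) : layer := w.1.2 v.
Definition pi_inf (v : peer n) : {perm flow} := w.2 v.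

Definition child (m : layer) (v : peer n) : peer n := sigma m v.
Definition parent (m : layer) (v : peer n) : peer n := (sigma m)^-1%g v.

Definition union_graph : rel (peer n) :=
  fun u v => [exists m : layer, child m u == v].

Definition dstar : int :=
  Num.ceil (ln (n.+1%:R / (ln n.+1%:R `^ c)) / ln 2 : R)%R.

(* d(v), with [None] for infinity *)
Definition dtrunc (v : peer n) : option nat :=
  if dist union_graph source v is Some k
  then if (k%:Z <= dstar)%R then Some k else None
  else None.

Definition admissible (v : peer n) (m : layer) : bool :=
  if dtrunc v is Some k.+1 then dtrunc (parent m v) == Some k else false.

(* Relevant only when 1 <= d(v) <= d^*, in which case at least one layer is
   admissible; [rev_ord] exchanges the two layers, so that the result is uniform
   on the set of admissible layers. *)
Definition mstar (v : peer n) : layer :=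
  if admissible v (tie v) then tie v else rev_ord (tie v).

(* [main_flow k v] is the main flow chi(v) when d(v) = k >= 1. *)
Fixpoint main_flow (k : nat) (v : peer n) : flow :=
  if k is k'.+1 then
    if k' == 0 then mstar v else main_flow k' (parent (mstar v) v)
  else mstar v.

(* The flow of the m-th incoming edge of v; [None] when it carries no flow. *)
Definition edge_flow (m : layer) (v : peer n) : option flow :=
  if v == source then None
  else if dtrunc v is Some k
  then Some (if m == mstar v then main_flow k v else rev_ord (main_flow k v))
  else Some (pi_inf v m).

Definition flow_graph (f : flow) : rel (peer n) :=
  fun u v => [exists m : layer, (parent m v == u) && (edge_flow m v == Some f)].

(* Since the source generates at most one chunk of each flow per slot, a chunk
   is identified by its flow and the slot of its generation. *)
Definition chunk := (flow * nat)%type.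

(* The pair (m, v) denotes the m-th incoming edge of v. *)
Definition edge := (layer * peer n)%type.

Section Dissemination.
(* [gen f t] : the source generates a chunk of flow f in slot t. *)
Variable gen : flow -> nat -> bool.

Definition generated (t : nat) (v : peer n) : seq chunk :=
  if v == source then [seq (f, t) | f <- enum 'I_2 & gen f t] else [::].

(* Q gives the contents of the queues at the beginning of the slot. *)
Definition delivered (Q : edge -> seq chunk) (v : peer n) : seq chunk :=
  pmap (fun m => ohead (Q (m, v))) (enum 'I_2).

(* [queue t (m, v)] is the FIFO queue, oldest chunk first, kept by the m-th
   parent of v for the m-th incoming edge of v, at the beginning of slot t. In
   slot t its head is transmitted, and the chunks generated or received in slot
   t are appended. *)
Fixpoint queue (t : nat) : edge -> seq chunk :=
  if t is t'.+1 then fun e =>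
    let: (m, v) := e in
    let u := parent m v in
    behead (queue t' e) ++
    [seq x <- delivered (queue t') u ++ generated t' u
       | edge_flow m v == Some x.1]
  else fun=> [::].

Definition received (t : nat) (v : peer n) : seq chunk := delivered (queue t) v.

End Dissemination.

Local Open Scope ring_scope.

Definition within_distance (f : flow) (b : R) (v : peer n) : Prop :=
  exists2 k : nat, dist (flow_graph f) source v = Some k & k%:R <= b.

(* Only reception over an incoming edge counts, so this fails for the source. *)
Definition within_delay (f : flow) (b : R) (v : peer n) : Prop :=
  forall (gen : flow -> nat -> bool) (t : nat), gen f t ->
  exists2 s : nat, s%:R <= t%:R + b & (f, t) \in received gen s v.

Definition good_peers (b : R) : {set peer n} :=
  [set v | `[< forall f : flow,
                 within_distance f b v /\ within_delay f b v >]].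

End Network.

(* Main.v *)
Require Import Defs.
From HB Require Import structures.
From mathcomp Require Import all_boot all_order all_algebra all_fingroup.
From mathcomp Require Import all_classical all_reals all_analysis.
(* [fintype] and [finset] again: [classical_sets] shadows [subsetP], [in_setU], etc. *)
From mathcomp Require Import fintype finset zify ring lra.
Set Implicit Arguments.
Unset Strict Implicit.
Unset Printing Implicit Defensive.
Import Order.TTheory GRing.Theory Num.Theory.
Import numFieldNormedType.Exports.

(* A first-moment argument: the mean fraction of bad peers tends to 0, and
   Markov's inequality concludes. The choices [tie] and [pi_inf] may be arbitrary;
   only the randomness of the permutations is used, through a switching argument:
   exchanging the images of two vertices in one layer is an involution of the
   sample space.

   Exploration. If B_j is the ball of radius j, its deficit 2^(j+1) - 1 - |B_j|
   at most doubles at each level, up to the number of collisions of the edges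
   leaving B_j, whose mean is O(4^j / N) by switching. So, with d = d^*, the mean
   deficit of B_d is O(4^d / N), which is small compared with 2^d. A small deficit
   leaves room for about 2^(d-1) peers of level d with main flow f (the frontier),
   and few peers have both parents in B_(d-1).

   Backward walk. From a peer v outside B_d follow the incoming edges of flow f.
   As long as the walk does not repeat itself, does not hit the frontier and does
   not hit a peer with both parents in B_(d-1), its next position may be switched
   with any vertex outside B_(d-1) and outside the trail, without affecting what
   has been explored. Each step therefore hits the frontier with probability at
   least of order log^(-c) N and fails with a much smaller probability, so that
   K = log^(c+eps) N steps suffice. The frontier is at distance d from the source
   in the flow graph. *)

(** * Exploration from the source *)

Lemma layerE (m l : 'I_2) : (l == m) || (l == rev_ord m).
Proof. by case: m l => [[|[|[]]]] ? // [[|[|[]]]] ?. Qed.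

Lemma rev_ord_neq (m : 'I_2) : rev_ord m != m.
Proof. by case: m => [[|[|[]]]] ?. Qed.

Lemma sum_pred (T : finType) (S : pred T) : \sum_x S x = #|[set x | S x]|.
Proof.
by rewrite -sum1dep_card [RHS]big_mkcond; apply: eq_bigr => x _; case: (S x).
Qed.

Lemma card_outcome_gt0 n : 0 < #|outcome n|.
Proof. by apply/card_gt0P; exists ([ffun=> 1%g], [ffun=> ord0], [ffun=> 1%g]). Qed.

Section Balls.
Variable n : nat.
Implicit Types (w : outcome n) (m l : layer) (a b u v x y z : peer n).

Fixpoint bfs w (j : nat) : {set peer n} :=
  if j is j'.+1 then
    [set v | (v == source) || [exists m, parent w m v \in bfs w j']]
  else [set source].

Definition doubly w (j : nat) : {set peer n} :=
  [set v | [forall m, parent w m v \in bfs w j]].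

(** Permutation products apply the left factor first, so [a] and [b] exchange their children in
    layer [m]. *)
Definition swap m a b w : outcome n :=
  ([ffun l => if l == m then (tperm a b * w.1.1 l)%g else w.1.1 l],
   w.1.2, w.2).

Lemma parent_swap m a b w l v : parent (swap m a b w) l v =
  if l == m then tperm a b (parent w l v) else parent w l v.
Proof.
rewrite /parent /sigma /swap /= ffunE; case: eqP => // _.
by rewrite invMg tpermV permM.
Qed.

Lemma swapK m a b : involutive (swap m a b).
Proof.
case=> [[s t] p]; rewrite /swap /=; congr (_, _, _).
apply/ffunP => l; rewrite !ffunE; case: eqP => // _.
by rewrite mulgA tperm2 mul1g.
Qed.

Lemma childK w m : cancel (child w m) (parent w m).
Proof. by move=> v; rewrite /parent /child permK. Qed.

Lemma parentK w m : cancel (parent w m) (child w m).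
Proof. by move=> v; rewrite /parent /child permKV. Qed.

Lemma parent_inj w m : injective (parent w m).
Proof. exact: can_inj (parentK w m). Qed.

Lemma child_swap m a b w : child (swap m a b w) m b = child w m a.
Proof.
apply: (@parent_inj (swap m a b w) m).
by rewrite childK parent_swap eqxx childK tpermL.
Qed.

Lemma in_bfsS w j v : (v \in bfs w j.+1) =
  (v == source) || [exists m, parent w m v \in bfs w j].
Proof. by rewrite inE. Qed.

Lemma source_bfs w j : source \in bfs w j.
Proof. by case: j => [|j]; rewrite !inE ?eqxx. Qed.

Lemma bfsS w j : bfs w j \subset bfs w j.+1.
Proof.
elim: j => [|j IH]; apply/subsetP => v.
  by rewrite in_bfsS inE => ->.
rewrite in_bfsS => /orP[/eqP ->|/existsP[m hm]]; first exact: source_bfs.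
by rewrite in_bfsS; apply/orP; right; apply/existsP; exists m; rewrite (subsetP IH).
Qed.

Lemma bfs_mono w j k : j <= k -> bfs w j \subset bfs w k.
Proof.
elim: k => [|k IH]; first by rewrite leqn0 => /eqP ->.
rewrite leq_eqVlt => /orP[/eqP -> //|/IH h].
exact: subset_trans h (bfsS _ _).
Qed.

Lemma in_bfs_mono w j k v : j <= k -> v \in bfs w j -> v \in bfs w k.
Proof. by move=> jk; apply/subsetP/bfs_mono. Qed.

Lemma parent_bfs w m j v : parent w m v \in bfs w j -> v \in bfs w j.+1.
Proof. by move=> h; rewrite in_bfsS; apply/orP; right; apply/existsP; exists m. Qed.

Lemma tperm_notin (B : {set peer n}) a b v : a \notin B -> b \notin B ->
  (tperm a b v \in B) = (v \in B).
Proof. by move=> /negbTE ha /negbTE hb; case: tpermP => [->|->|]; rewrite ?ha ?hb. Qed.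

(** A ball depends on the parents only through membership in the previous ball, which transposing
    two outside vertices preserves. As only radii [i < k] are constrained, [a] may lie on level
    [k]. *)
Lemma bfs_swap m a b w k :
  (forall i, i < k -> a \notin bfs w i /\ b \notin bfs w i) ->
  forall i, i <= k -> bfs (swap m a b w) i = bfs w i.
Proof.
move=> h; elim=> [//|i IH] ik; apply/setP => v; rewrite !in_bfsS; congr (_ || _).
apply: eq_existsb => l; rewrite IH ?(ltnW ik) // parent_swap.
by case: eqP => // _; have [ha hb] := h _ ik; rewrite tperm_notin.
Qed.

Lemma card_parent_preim w m (B : {set peer n}) :
  #|[set v | parent w m v \in B]| = #|B|.
Proof. by rewrite -[RHS](card_preimset B (@parent_inj w m)); apply: eq_card => v; rewrite !inE. Qed.

Lemma bfsSE w j : bfs w j.+1 =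
  source |: ([set v | parent w ord0 v \in bfs w j] :|:
             [set v | parent w ord_max v \in bfs w j]).
Proof.
apply/setP => v; rewrite in_bfsS !in_setU in_set1 !in_set; congr (_ || _); apply/existsP/orP.
  case=> m; have /orP[/eqP->|/eqP->] := layerE ord0 m; first by left.
  suff -> : rev_ord (ord0 : 'I_2) = ord_max by right.
  by apply/val_inj.
by case=> h; eexists; apply: h.
Qed.

Lemma doublyE w j : doubly w j =
  [set v | parent w ord0 v \in bfs w j] :&:
  [set v | parent w ord_max v \in bfs w j].
Proof.
apply/setP => v; rewrite in_setI !in_set; apply/forallP/andP => [h|[h0 h1] m].
  by split; apply: h.
have /orP[/eqP->//|/eqP->] := layerE ord0 m.
by suff -> : rev_ord (ord0 : 'I_2) = ord_max by []; apply/val_inj.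
Qed.

(* The next ball falls short of [2 * #|bfs w j| + 1] vertices only
   through collisions of the outgoing edges, or through edges into the source. *)
Lemma card_bfsS w j :
  #|bfs w j.+1| + #|doubly w j| +
    [exists m, parent w m source \in bfs w j] = (2 * #|bfs w j|).+1.
Proof.
rewrite bfsSE doublyE cardsU1.
set P := [set v | parent w ord0 v \in _]; set Q := [set v | parent w ord_max v \in _].
have hPQ : #|P :|: Q| + #|P :&: Q| = 2 * #|bfs w j|.
  by rewrite cardsUI !card_parent_preim mul2n addnn.
have -> : [exists m, parent w m source \in bfs w j] = (source \in P :|: Q).
  rewrite in_setU !in_set; apply/existsP/orP.
    case=> m; have /orP[/eqP->|/eqP->] := layerE ord0 m; first by left.
    suff -> : rev_ord (ord0 : 'I_2) = ord_max by right.
    by apply/val_inj.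
  by case=> h; eexists; apply: h.
by rewrite -hPQ; case: (source \in P :|: Q); rewrite ?add0n ?add1n ?addn0 ?addn1 ?addSn.
Qed.

Lemma card_bfs w j : #|bfs w j| < 2 ^ j.+1.
Proof.
elim: j => [|j IH]; first by rewrite cards1.
have := card_bfsS w j; have := expnS 2 j.+1; lia.
Qed.

(** [2 ^ j.+1 - 1] is the size of a complete binary tree of height [j]; by [card_bfs] the truncated
    subtraction is exact. *)
Definition deficit w j := 2 ^ j.+1 - 1 - #|bfs w j|.

Lemma deficitS w j : deficit w j.+1 =
  2 * deficit w j + #|doubly w j| + [exists m, parent w m source \in bfs w j].
Proof.
rewrite /deficit; have := card_bfsS w j; have := card_bfs w j.
have := card_bfs w j.+1; rewrite (expnS 2 j.+1); lia.
Qed.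

End Balls.

(** * Switching and the mean number of collisions *)

Section Collisions.
Variable n : nat.
Implicit Types (w : outcome n) (m l : layer) (a b u v x y z : peer n).

(** Switching as double counting: for fixed [a] and [b] the swap is injective on the outcomes
    satisfying [P], since the layer [mm w] is recovered from the image. *)
Lemma sum_swap (mm : outcome n -> layer) (P Q : outcome n -> rel (peer n)) :
  (forall w a b, P w a b -> mm (swap (mm w) a b w) = mm w /\
                            Q (swap (mm w) a b w) a b) ->
  \sum_w \sum_a \sum_b P w a b <= \sum_w \sum_a \sum_b Q w a b.
Proof.
move=> h; rewrite exchange_big [leqRHS]exchange_big; apply: leq_sum => a _.
rewrite exchange_big [leqRHS]exchange_big; apply: leq_sum => b _.
rewrite !sum_pred -(@card_in_imset _ _ (fun w => swap (mm w) a b w)).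
  apply/subset_leq_card/subsetP => x /imsetP[w].
  by rewrite !inE => /h[_ hQ] ->.
move=> w w'; rewrite !inE => /h[hm _] /h[hm' _] e.
have em : mm w = mm w' by rewrite -hm -hm' e.
by apply: (can_inj (swapK (mm w) a b)); rewrite e em.
Qed.

(** [i] is the level of [x]. Exchanging the children of [x] and [b] can affect only balls of radius
    beyond [i]. *)
Lemma first_bfs w x b j : x \in bfs w j -> b \notin bfs w j ->
  exists i, [/\ i <= j, x \in bfs w i, (forall k, k < i -> x \notin bfs w k) &
    forall m k, k <= i -> bfs (swap m x b w) k = bfs w k].
Proof.
move=> xj bj; have ex_k : exists i, x \in bfs w i by exists j.
case: (ex_minnP ex_k) => i xi i_min; have ij : i <= j by exact: i_min.
have first k : k < i -> x \notin bfs w k by move=> ki; apply/negP => /i_min; lia.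
exists i; split=> // m; apply: bfs_swap => k ki; split; first exact: first.
by apply: contra bj; apply: in_bfs_mono; lia.
Qed.

(* For [x] on level [i <= j]: [z] is the source or the other parent of [z] has
   level at most [i]. Every edge closing a cycle of the explored graph is, from
   one of its two ends, such an edge, and swapping the image of [x] with that of
   a vertex outside [bfs w j] does not affect the condition. *)
Definition early m j w x z :=
  (z == source) ||
  [forall k : 'I_j.+1, (x \in bfs w k) ==> (parent w (rev_ord m) z \in bfs w k)].

Definition hits m j w := [set x in bfs w j | early m j w x (child w m x)].

(** Only the level [i] of [x] matters. The balls up to radius [i] survive the swap, and so do the
    parents in the other layer, on which [early] depends. *)
Lemma early_swap m j w x b z : x \in bfs w j -> b \notin bfs w j ->
  early m j w x z -> early m j (swap m x b w) x z.
Proof.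
move=> xj bj /orP[/eqP->|/forallP h]; apply/orP; first by left; rewrite eqxx.
right; apply/forallP => k; apply/implyP => xk.
have [i [ij xi i_min same]] := first_bfs xj bj.
have ik : i <= k.
  rewrite leqNgt; apply/negP => ki; have := i_min _ ki.
  by rewrite -(same m k) ?xk // ltnW.
apply: (in_bfs_mono ik); rewrite same // parent_swap (negbTE (rev_ord_neq m)).
have i_lt : i < j.+1 by [].
by have := h (Ordinal i_lt); rewrite xi.
Qed.

(** At [k = j] the condition puts the other parent of [z] in the ball; the source adds one vertex,
    absorbed by the strict bound [card_bfs]. *)
Lemma card_early m j w x : x \in bfs w j ->
  #|[set z | early m j w x z]| <= 2 ^ j.+1.
Proof.
move=> xj; apply: (@leq_trans #|source |: [set z | parent w (rev_ord m) z \in bfs w j]|).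
  apply/subset_leq_card/subsetP => z; rewrite in_setU1 !inE.
  case/orP => [->//|/forallP/(_ ord_max)]; by rewrite xj /= => ->; rewrite orbT.
rewrite cardsU1 card_parent_preim; have := card_bfs w j.
by case: (_ \notin _); lia.
Qed.

(** A hit at [x] can be switched with any of the at least [n.+1 - 2 ^ j.+1] vertices [b] outside the
    ball. Afterwards [x] is still in the ball and the child of [b] is early for [x], which leaves at
    most [2 ^ j.+1] choices for each of [x] and [b]. *)
Lemma sum_hits m j :
  (n.+1 - 2 ^ j.+1) * \sum_(w : outcome n) #|hits m j w| <= 4 ^ j.+1 * #|outcome n|.
Proof.
pose P w := [rel x b | (x \in hits m j w) && (b \notin bfs w j)].
pose Q w := [rel x b | (x \in bfs w j) && early m j w x (child w m b)].
apply: (@leq_trans (\sum_w \sum_x \sum_b P w x b)).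
  rewrite big_distrr; apply: leq_sum => w _ /=.
  rewrite -sum1_card big_distrr /= big_mkcond /=; apply: leq_sum => x _.
  case: ifP => // _; rewrite muln1 sum_pred.
  have -> : [set b | b \notin bfs w j] = ~: bfs w j by apply/setP => b; rewrite !inE.
  have := cardsC (bfs w j); rewrite card_ord; have := card_bfs w j.
  move=> /ltnW h /esym/eq_leq e; rewrite leq_subLR; apply: leq_trans e _.
  by rewrite leq_add2r.
apply: leq_trans (sum_swap (mm := fun=> m) (Q := Q) _) _.
  move=> w x b /= /andP[]; rewrite inE => /andP[xj xe] bj; split=> //.
  rewrite child_swap early_swap // andbT.
  have [i [ij xi _ same]] := first_bfs xj bj.
  by apply: (in_bfs_mono ij); rewrite same.
rewrite mulnC -sum_nat_const; apply: leq_sum => w _.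
apply: (@leq_trans (\sum_(x in bfs w j) 2 ^ j.+1)).
  rewrite [leqRHS]big_mkcond; apply: leq_sum => x _ /=.
  case: ifP => xj; last by rewrite big1.
  rewrite sum_pred; apply: leq_trans (card_early m xj).
  have -> : [set b | early m j w x (child w m b)] =
            [set b | child w m b \in [set z | early m j w x z]].
    by apply/setP => b; rewrite !inE.
  rewrite -[leqRHS](card_preimset _ (can_inj (childK w m))).
  by apply/subset_leq_card/subsetP => b; rewrite !inE.
have -> : 4 ^ j.+1 = 2 ^ j.+1 * 2 ^ j.+1 by rewrite -expnMn.
by rewrite sum_nat_const leq_mul2r (ltnW (card_bfs w j)) orbT.
Qed.

(** Of the two edges into a vertex of [doubly w j], one whose tail has the larger level is early. *)
Lemma card_doubly_hits w j : #|doubly w j| <= \sum_m #|hits m j w|.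
Proof.
apply: (@leq_trans #|\bigcup_m (child w m @: hits m j w)|).
  apply/subset_leq_card/subsetP => z; rewrite inE => /forallP hz.
  suff [m hm] : exists m, early m j w (parent w m z) z.
    apply/bigcupP; exists m => //; apply/imsetP; exists (parent w m z).
      by rewrite inE hz parentK.
    by rewrite parentK.
  case: (boolP (early ord0 j w (parent w ord0 z) z)) => [h|]; first by exists ord0.
  rewrite negb_or negb_forall => /andP[_ /existsP[k]].
  rewrite negb_imply => /andP[h0 h1].
  exists (rev_ord ord0); apply/orP; right; apply/forallP => i; apply/implyP => hi.
  rewrite rev_ordK; apply: in_bfs_mono h0.
  by rewrite leqNgt; apply/negP => /ltnW ik; rewrite (in_bfs_mono ik hi) in h1.
elim/big_rec2: _ => [|m B k _ hk]; first by rewrite cards0.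
apply: leq_trans (leq_card_setU _ _) _.
by rewrite leq_add // leq_imset_card.
Qed.

Lemma source_hits w j :
  [exists m, parent w m source \in bfs w j] <= \sum_m #|hits m j w|.
Proof.
case: existsP => // -[m hm] /=; rewrite (bigD1 m) //=.
apply: leq_trans (leq_addr _ _); rewrite card_gt0; apply/set0Pn.
by exists (parent w m source); rewrite inE hm /early parentK eqxx.
Qed.

(** Each of the two collision terms of [deficitS] is at most the number of hits in the two layers.
    In units of [4 ^ j] the induction closes by 2 * 16 + 4 * 4 <= 16 * 4. *)
Lemma sum_deficit d j : j <= d ->
  (n.+1 - 2 ^ d) * \sum_(w : outcome n) deficit w j <= 16 * 4 ^ j * #|outcome n|.
Proof.
elim: j => [|j IH] jd.
  rewrite big1 ?muln0 // => w _; by rewrite /deficit cards1.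
move: IH => /(_ (ltnW jd)) IH.
have hm m : (n.+1 - 2 ^ d) * \sum_(w : outcome n) #|hits m j w| <= 4 ^ j.+1 * #|outcome n|.
  apply: leq_trans (sum_hits m j); rewrite leq_mul2r leq_sub2l ?orbT //.
  by rewrite leq_exp2l.
have step : \sum_(w : outcome n) deficit w j.+1 <=
    2 * \sum_(w : outcome n) deficit w j + 2 * \sum_m \sum_(w : outcome n) #|hits m j w|.
  rewrite exchange_big !big_distrr -big_split /=; apply: leq_sum => w _.
  rewrite deficitS -addnA leq_add2l (mul2n (\sum_m _)) -addnn.
  by rewrite leq_add ?card_doubly_hits ?source_hits.
have h0 := hm ord0; have h1 := hm (lift ord0 ord0).
move: step; rewrite big_ord_recl big_ord1 => step.
rewrite (expnS 4 j).
move: step IH h0 h1; rewrite (expnS 4 j) !mulnDr.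
move: (\sum_w _) (\sum_w _) (\sum_w _) (\sum_w _) (n.+1 - 2 ^ d) => D' D h h' M.
nia.
Qed.

End Collisions.

(** * Distances and flows *)

Lemma walk0 (T : finType) (e : rel T) x y : walk e x y 0 = (x == y).
Proof.
apply/existsP/idP => [[p]|xy]; first by rewrite (tuple0 p).
by exists [tuple].
Qed.

Lemma walkSP (T : finType) (e : rel T) x y k :
  reflect (exists2 z, walk e x z k & e z y) (walk e x y k.+1).
Proof.
apply: (iffP existsP) => [[p /andP[ep /eqP lp]]|[z /existsP[p /andP[ep /eqP lp]] ezy]].
  case/lastP: (tval p) (size_tuple p) ep lp => // q z; rewrite size_rcons => -[sq].
  rewrite rcons_path last_rcons => /andP[eq ez] <-.
  exists (last x q) => //; apply/existsP; exists (tcast sq (in_tuple q)).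
  by rewrite val_tcast eq eqxx.
have sp : size (rcons p y) == k.+1 by rewrite size_rcons size_tuple.
by exists (Tuple sp); rewrite /= rcons_path last_rcons ep lp ezy eqxx.
Qed.

Lemma dist_SomeP (T : finType) (e : rel T) x y k :
  dist e x y = Some k <-> walk e x y k /\ (forall i, walk e x y i -> k <= i).
Proof.
rewrite /dist; case: pselect => [h|h]; last first.
  by split=> [//|[wk _]]; case: h; exists k.
case: ex_minnP => j wj jmin; split=> [[<-]//|[wk kmin]].
by congr Some; apply/eqP; rewrite eqn_leq jmin // kmin.
Qed.

Lemma dist_walk (T : finType) (e : rel T) x y k : walk e x y k ->
  exists2 j, dist e x y = Some j & j <= k.
Proof.
move=> wk; have ex : exists i, walk e x y i by exists k.
case: (ex_minnP ex) => j wj jmin; exists j; last exact: jmin.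
by apply/dist_SomeP.
Qed.

Section Flows.
Variables (R : realType) (c : R) (n d : nat).
(** Here [d] is d^* - 1: the frontier is on level [d.+1], and swaps must avoid [bfs w d]. *)
Hypothesis dstarE : dstar c n = Posz d.+1.
Implicit Types (w : outcome n) (m l : layer) (a b u v x y z : peer n) (f : flow).

Lemma bfsP w j v :
  reflect (exists2 i, i <= j & walk (union_graph w) source v i) (v \in bfs w j).
Proof.
elim: j v => [|j IH] v.
  rewrite in_set1; apply: (iffP eqP) => [->|[[|i]]//]; first by exists 0; rewrite ?walk0.
  by rewrite walk0 => _ /eqP.
rewrite in_bfsS; apply: (iffP orP) => [[/eqP->|/existsP[m /IH[i ij wi]]]|[[|i] ij]].
- by exists 0; rewrite ?walk0.
- exists i.+1 => //; apply/walkSP; exists (parent w m v) => //.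
  by apply/existsP; exists m; rewrite parentK.
- by rewrite walk0 eq_sym; left.
- case/walkSP => z wz /existsP[m /eqP mz]; right; apply/existsP; exists m.
  by apply/IH; exists i => //; rewrite -mz childK.
Qed.

Lemma dtruncP w v k : dtrunc c w v = Some k <->
  [/\ k <= d.+1, v \in bfs w k & forall i, i < k -> v \notin bfs w i].
Proof.
have distE : dist (union_graph w) source v = Some k <->
    v \in bfs w k /\ forall i, i < k -> v \notin bfs w i.
  rewrite dist_SomeP; split=> [[wk kmin]|[/bfsP[i ik wi] kmin]].
    split; first by apply/bfsP; exists k.
    by move=> i ik; apply/bfsP => -[j ji /kmin]; lia.
  have kE : forall j, walk (union_graph w) source v j -> k <= j.
    move=> j wj; rewrite leqNgt; apply/negP => /kmin/negP; apply.
    by apply/bfsP; exists j.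
  split=> //; suff -> : k = i by [].
  by apply/eqP; rewrite eqn_leq ik kE.
rewrite /dtrunc dstarE; case E : dist => [j|]; last first.
  by split=> [//|[_ vk kmin]]; have /distE := conj vk kmin; rewrite E.
rewrite lez_nat; case: ifP => jd.
  split=> [[jk]|[kd vk kmin]].
    by move: E jd; rewrite jk => /distE[vk kmin] kd.
  by rewrite -E; apply/distE.
split=> [//|[kd vk kmin]]; have /distE := conj vk kmin; rewrite E => -[jk].
by rewrite jk kd in jd.
Qed.

Lemma dtrunc_in w v k : dtrunc c w v = Some k -> v \in bfs w k.
Proof. by case/dtruncP. Qed.

Lemma dtrunc_le w v k : dtrunc c w v = Some k -> k <= d.+1.
Proof. by case/dtruncP. Qed.

Lemma dtrunc0 w v : (dtrunc c w v == Some 0) = (v == source).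
Proof.
apply/eqP/eqP => [/dtrunc_in|->]; first by rewrite in_set1 => /eqP.
by apply/dtruncP; split=> //; rewrite source_bfs.
Qed.

Lemma dtruncN w v : v \notin bfs w d.+1 -> dtrunc c w v = None.
Proof.
case E : dtrunc => [k|] //; have /dtruncP[kd vk _] := E.
by rewrite (in_bfs_mono kd).
Qed.

Lemma dtrunc_top w v : v \in bfs w d.+1 -> v \notin bfs w d ->
  dtrunc c w v = Some d.+1.
Proof.
move=> vd vNd; apply/dtruncP; split=> // i id.
by apply: contra vNd; apply: in_bfs_mono.
Qed.

Lemma admissible_ex w v k : dtrunc c w v = Some k.+1 ->
  exists m, dtrunc c w (parent w m v) = Some k.
Proof.
case/dtruncP => kd; rewrite in_bfsS => /orP[/eqP -> /(_ 0)|/existsP[m hm] kmin].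
  by rewrite source_bfs => /(_ isT).
exists m; apply/dtruncP; split; [exact: ltnW|by []|] => i ik.
by apply/negP => /parent_bfs; apply/negP/kmin.
Qed.

Lemma admissible_mstar w v k : dtrunc c w v = Some k.+1 ->
  dtrunc c w (parent w (mstar c w v) v) = Some k.
Proof.
move=> vk; rewrite /mstar; case: ifP => [|adm].
  by rewrite /admissible vk => /eqP.
have [m hm] := admissible_ex vk.
have /orP[/eqP em|/eqP <- //] := layerE (tie w v) m.
by move: adm; rewrite /admissible vk -em hm eqxx.
Qed.

Lemma admissibleP w v m k : dtrunc c w v = Some k.+1 ->
  admissible c w v m = (dtrunc c w (parent w m v) == Some k).
Proof. by rewrite /admissible => ->. Qed.

(** * Invariance of distances and flows under swaps outside the ball *)

Section Swap.
Variables (m : layer) (a b : peer n) (w : outcome n).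
Hypotheses (ha : a \notin bfs w d) (hb : b \notin bfs w d).
Let w' := swap m a b w.

Lemma bfs_swap_deep i : i <= d.+1 -> bfs w' i = bfs w i.
Proof.
apply: bfs_swap => j; rewrite ltnS => jd.
by split; [move: ha|move: hb]; apply: contra; apply: in_bfs_mono.
Qed.

Lemma parent_swap_deep l v : parent w l v \in bfs w d -> parent w' l v = parent w l v.
Proof.
move=> h; rewrite parent_swap; case: eqP => // _.
by rewrite tpermD //; apply/eqP => e; [move: ha|move: hb]; rewrite e h.
Qed.

Lemma in_parent_swap l v : (parent w' l v \in bfs w d) = (parent w l v \in bfs w d).
Proof. by rewrite parent_swap; case: eqP => // _; rewrite tperm_notin. Qed.

Lemma dtrunc_swap v : dtrunc c w' v = dtrunc c w v.
Proof.
have h k : dtrunc c w' v = Some k <-> dtrunc c w v = Some k.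
  split=> /dtruncP[kd vk kmin]; apply/dtruncP; split=> //.
  - by rewrite -bfs_swap_deep.
  - by move=> i ik; rewrite -bfs_swap_deep ?kmin //; lia.
  - by rewrite bfs_swap_deep.
  - by move=> i ik; rewrite bfs_swap_deep ?kmin //; lia.
case E : (dtrunc c w v) => [k|]; first exact/h.
by case E' : (dtrunc c w' v) => [k|] //; move/h: E'; rewrite E.
Qed.

(** A parent in [bfs w d] is not moved; a parent outside it stays outside, and so never has distance
    [k <= d]. *)
Lemma admissible_swap v l : admissible c w' v l = admissible c w v l.
Proof.
case E : (dtrunc c w v) => [[|k]|]; try by rewrite /admissible dtrunc_swap E.
have kd : k <= d by have := dtrunc_le E.
rewrite !(@admissibleP _ _ _ k) ?dtrunc_swap //.
case: (boolP (parent w l v \in bfs w d)) => h; first by rewrite parent_swap_deep.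
have h' := h; rewrite -in_parent_swap in h'.
suff hN u : u \notin bfs w d -> (dtrunc c w u == Some k) = false by rewrite !hN.
move=> hu; apply/negbTE; apply: contra hu => /eqP/dtrunc_in.
exact: in_bfs_mono.
Qed.

Lemma mstar_swap v : mstar c w' v = mstar c w v.
Proof. by rewrite /mstar admissible_swap. Qed.

Lemma main_flow_swap k v : dtrunc c w v = Some k ->
  main_flow c w' k v = main_flow c w k v.
Proof.
elim: k v => [|k IH] v vk /=; first exact: mstar_swap.
rewrite mstar_swap; case: eqP => // _; have hp := admissible_mstar vk.
have kd : k <= d by have := dtrunc_le vk.
by rewrite parent_swap_deep ?IH // (in_bfs_mono kd) // (dtrunc_in hp).
Qed.

(** The flow of an edge is attached to its layer and head. It is determined by [tie] and the
    exploration up to level [d.+1], and by [pi_inf] beyond, none of which the swap changes. *)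
Lemma edge_flow_swap l v : edge_flow c w' l v = edge_flow c w l v.
Proof.
rewrite /edge_flow dtrunc_swap mstar_swap; case: eqP => // _.
by case E : dtrunc => [k|] //; rewrite main_flow_swap.
Qed.

End Swap.

(** For [v != source] this is the unique layer whose edge into [v] carries [f]; the value at the
    source is a default. *)
Definition flow_layer w f v : layer :=
  if edge_flow c w ord0 v == Some f then ord0 else rev_ord ord0.

Definition flow_parent w f v : peer n := parent w (flow_layer w f v) v.

Lemma edge_flow_inj w v l l' f : edge_flow c w l v = Some f ->
  edge_flow c w l' v = Some f -> l = l'.
Proof.
rewrite /edge_flow; case: eqP => // _; case: dtrunc => [k|] /=; last first.
  by move=> [<-] [/perm_inj].
have [/eqP->|/eqP->] := orP (layerE (mstar c w v) l);
  have [/eqP->|/eqP->] := orP (layerE (mstar c w v) l') => //;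
  rewrite ?eqxx (negbTE (rev_ord_neq _)).
- by move=> -[<-] [e]; have := rev_ord_neq (main_flow c w k v); rewrite e eqxx.
- by move=> -[<-] [e]; have := rev_ord_neq (main_flow c w k v); rewrite -e eqxx.
Qed.

Lemma edge_flow_layer w f v : v != source -> edge_flow c w (flow_layer w f v) v = Some f.
Proof.
move=> vs; rewrite /flow_layer; case: eqP => // /eqP.
have ex l : exists f', edge_flow c w l v = Some f'.
  by rewrite /edge_flow (negbTE vs); case: dtrunc => [k|]; eexists.
have [f0 e0] := ex ord0; have [f1 e1] := ex (rev_ord ord0).
rewrite e0 e1 => /eqP ff0; congr Some.
have f10 : f1 != f0.
  apply/eqP => f10; have := edge_flow_inj e0; rewrite -f10 => /(_ _ e1)/eqP.
  by rewrite eq_sym (negbTE (rev_ord_neq _)).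
have [/eqP f1E|/eqP f1E] := orP (layerE f f1); first by [].
have [/eqP f0E|/eqP f0E] := orP (layerE f f0); first by rewrite f0E in ff0.
by rewrite f0E f1E eqxx in f10.
Qed.

Lemma flow_graph_parent w f v : v != source -> flow_graph c w f (flow_parent w f v) v.
Proof. by move=> vs; apply/existsP; exists (flow_layer w f v); rewrite eqxx edge_flow_layer ?eqxx. Qed.

Lemma edge_flow_mstar w v k : dtrunc c w v = Some k.+1 ->
  edge_flow c w (mstar c w v) v = Some (main_flow c w k.+1 v).
Proof.
move=> vk; rewrite /edge_flow vk eqxx; case: eqP => // vs.
by move: vk; rewrite vs => e; have := dtrunc0 w source; rewrite e eqxx.
Qed.

(** The main flow is inherited along [mstar] parents, each one level nearer to the source, so the
    whole walk lies in one flow graph. *)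
Lemma walk_main_flow w v k : dtrunc c w v = Some k.+1 ->
  walk (flow_graph c w (main_flow c w k.+1 v)) source v k.+1.
Proof.
elim: k v => [|k IH] v vk; apply/walkSP; exists (parent w (mstar c w v) v).
- by rewrite walk0 eq_sym -(dtrunc0 w) (admissible_mstar vk).
- by apply/existsP; exists (mstar c w v); rewrite eqxx (edge_flow_mstar vk) ?eqxx.
- by rewrite /= -/(main_flow c w k.+1 _); apply/IH/admissible_mstar.
- by apply/existsP; exists (mstar c w v); rewrite eqxx (edge_flow_mstar vk) ?eqxx.
Qed.

End Flows.

(** * Backward walk along a flow *)

Section BackwardWalk.
Variables (R : realType) (c : R) (n d : nat).
Hypothesis dstarE : dstar c n = Posz d.+1.
Variables (f : flow) (v0 : peer n).
Implicit Types (w : outcome n) (m l : layer) (a b u v x y z : peer n).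

Definition flow_level w g k : {set peer n} :=
  [set v | (dtrunc c w v == Some k.+1) && (main_flow c w k.+1 v == g)].

(** On level 1 only the child of the source in layer [g] can have main flow [g]. Beyond, the main
    flow is inherited from the [mstar] parent, and each peer has two children. *)
Lemma card_flow_level w g k : #|flow_level w g k| <= 2 ^ k.
Proof.
elim: k => [|k IH].
  rewrite expn0 -(cards1 (child w g source)); apply/subset_leq_card/subsetP => v.
  rewrite in_set in_set1 => /andP[/eqP vk /eqP /= <-].
  have := admissible_mstar dstarE vk => /eqP; rewrite (dtrunc0 dstarE) => /eqP <-.
  by rewrite parentK.
rewrite expnS mul2n -addnn; pose P m := [set v | parent w m v \in flow_level w g k].
apply: (@leq_trans #|P ord0 :|: P (rev_ord ord0)|); last first.
  by apply: leq_trans (leq_card_setU _ _) _; rewrite !card_parent_preim leq_add.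
apply/subset_leq_card/subsetP => v; rewrite in_set => /andP[/eqP vk /eqP vg].
suff : v \in P (mstar c w v).
  have [/eqP->|/eqP->] := orP (layerE ord0 (mstar c w v)); rewrite in_setU => ->//.
  by rewrite orbT.
rewrite !in_set (admissible_mstar dstarE vk) eqxx /=.
by rewrite -vg.
Qed.

Definition frontier w := flow_level w f d.

(** At most [2 ^ d] peers of level [d.+1] have the other main flow, [bfs w d] has at most
    [2 ^ d.+1 - 1] peers, and [bfs w d.+1] has [2 ^ d.+2 - 1 - deficit w d.+1]. *)
Lemma card_frontier w : 2 ^ d <= #|frontier w| + deficit w d.+1.
Proof.
have hsub : bfs w d.+1 \subset
    bfs w d :|: (frontier w :|: flow_level w (rev_ord f) d).
  apply/subsetP => v vd; rewrite !in_setU; case: (boolP (v \in bfs w d)) => //= vNd.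
  rewrite !in_set (dtrunc_top dstarE vd vNd) eqxx !andTb.
  exact: layerE.
have := subset_leq_card hsub => /leq_trans/(_ (leq_card_setU _ _)) h.
have h' := leq_trans h (leq_add (leqnn _) (leq_card_setU _ _)).
move: h' (card_flow_level w (rev_ord f) d) (card_bfs w d) (card_bfs w d.+1).
rewrite /deficit !expnS.
move: #|bfs w d.+1| #|bfs w d| #|frontier w| #|flow_level _ _ _| (2 ^ d).
move=> B' B A A' q; lia.
Qed.

(** Entering [frontier w] is success and entering [doubly w d] is failure; [bfs w d] cannot be
    entered from outside [stop w], by [flow_parent_notin]. *)
Definition stop w := bfs w d :|: (frontier w :|: doubly w d).

(** If the flow-[f] parent were in [bfs w d], then [v] would be on level [d.+1]. Either this parent
    is the [mstar] one, so that [f] is the main flow and [v] is in the frontier, or both parents are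
    in the ball. *)
Lemma flow_parent_notin w v : v \notin stop w -> flow_parent c w f v \notin bfs w d.
Proof.
rewrite !in_setU !negb_or => /and3P[vN vA vD].
have vs : v != source by apply: contraNneq vN => ->; rewrite source_bfs.
apply/negP => hp; have vd := parent_bfs hp.
have vk := dtrunc_top dstarE vd vN.
have ef := edge_flow_layer c w f vs.
have em := edge_flow_mstar dstarE vk.
have hm := in_bfs_mono (leqnn _) (dtrunc_in dstarE (admissible_mstar dstarE vk)).
have [/eqP e|/eqP e] := orP (layerE (mstar c w v) (flow_layer c w f v)).
  by move: ef vA; rewrite e em in_set vk eqxx /= => -[->]; rewrite eqxx.
move/negP: vD; apply; rewrite in_set; apply/forallP => m.
have [/eqP->//|/eqP->] := orP (layerE (mstar c w v) m).
by rewrite -e.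
Qed.

Definition pos w i := iter i (flow_parent c w f) v0.

Arguments pos : simpl never.

Lemma posS w i : pos w i.+1 = flow_parent c w f (pos w i).
Proof. by []. Qed.

Definition trail w i := mkseq (pos w) i.+1.

Definition alive w i := all (fun v => v \notin stop w) (trail w i) && uniq (trail w i).

Lemma mem_trail w i j : j <= i -> pos w j \in trail w i.
Proof. by move=> ji; apply/mapP; exists j => //; rewrite mem_iota. Qed.

Lemma alive_stop w i j : alive w i -> j <= i -> pos w j \notin stop w.
Proof. by case/andP=> /allP h _ ji; apply/h/mem_trail. Qed.

Lemma aliveS w i : alive w i.+1 =
  [&& alive w i, pos w i.+1 \notin stop w & pos w i.+1 \notin trail w i].
Proof.
rewrite /alive {1 2}/trail mkseqS -/(trail w i) all_rcons rcons_uniq.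
move: (all _ _) (uniq _) (_ \notin stop w) (_ \notin trail w i).
by do 4!case.
Qed.

(** * Redirecting the last step of the walk *)

Section Swap.
Variables (w : outcome n) (i : nat) (b : peer n).
Hypotheses (hw : alive w i) (bH : b \notin bfs w d) (bT : b \notin trail w i).
Let m := flow_layer c w f (pos w i).
Let w' := swap m (pos w i.+1) b w.

Let aH : pos w i.+1 \notin bfs w d.
Proof. exact: flow_parent_notin (alive_stop hw (leqnn i)). Qed.

Lemma flow_layer_swap v : flow_layer c w' f v = flow_layer c w f v.
Proof. by rewrite /flow_layer (edge_flow_swap dstarE). Qed.

Lemma frontier_swap : frontier w' = frontier w.
Proof.
apply/setP => v; rewrite !in_set (dtrunc_swap dstarE) //.
by case: eqP => // vk; rewrite (main_flow_swap dstarE).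
Qed.

Lemma doubly_swap : doubly w' d = doubly w d.
Proof.
apply/setP => v; rewrite !in_set; apply: eq_forallb => l.
by rewrite (bfs_swap_deep _ aH bH) // in_parent_swap.
Qed.

Lemma stop_swap : stop w' = stop w.
Proof. by rewrite /stop frontier_swap doubly_swap (bfs_swap_deep _ aH bH). Qed.

Lemma deficit_swap : deficit w' d.+1 = deficit w d.+1.
Proof. by rewrite /deficit (bfs_swap_deep _ aH bH). Qed.

(** Earlier steps in layer [m] lead to neither transposed vertex: [b] is off the trail, and
    [pos w i.+1 = pos w j.+1] through the same layer would give [pos w i = pos w j] by injectivity
    of [parent]. The vertex [pos w i.+1] may itself lie on the trail, as [card_lost] requires. *)
Lemma pos_swap j : j <= i -> pos w' j = pos w j.
Proof.
elim: j => [//|j IH] ji; rewrite !posS (IH (ltnW ji)).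
rewrite /flow_parent flow_layer_swap parent_swap; case: (eqVneq _ m) => [lm|_]; last by reflexivity.
have pj : parent w (flow_layer c w f (pos w j)) (pos w j) = pos w j.+1 by [].
have bj : b != pos w j.+1.
  by apply/eqP => e; move: bT; rewrite e (@mem_trail w i j.+1 ji).
suff aj : pos w i.+1 != pos w j.+1 by rewrite pj (tpermD aj bj).
apply/eqP => e; have e' : pos w i = pos w j.
  by apply: (@parent_inj _ w m); rewrite -[in RHS]lm pj -e posS.
have /andP[_ /mkseq_uniqP inj] := hw.
have hj : j \in gtn i.+1 by rewrite inE; apply: (leq_trans ji).
have ij : i = j by exact: (inj _ _ (ltnSn i) hj e').
by rewrite ij ltnn in ji.
Qed.

Lemma trail_swap : trail w' i = trail w i.
Proof.
by apply/eq_in_map => j; rewrite mem_iota /= => ji; rewrite pos_swap.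
Qed.

Lemma alive_swap : alive w' i.
Proof. by rewrite /alive trail_swap stop_swap. Qed.

Lemma pos_swapS : pos w' i.+1 = b.
Proof.
rewrite posS (pos_swap (leqnn i)) /flow_parent flow_layer_swap parent_swap eqxx.
by rewrite posS tpermL.
Qed.

Lemma swap_layer : flow_layer c w' f (pos w' i) = m.
Proof. by rewrite (pos_swap (leqnn i)) flow_layer_swap. Qed.

End Swap.

(** * Success and failure of the walk *)

Variable dl : nat.

Definition regular w := deficit w d.+1 <= dl.

Definition alive_set i := [set w | alive w i && regular w].

(** Step [i.+1] is redirected to any vertex [b] of the frontier, of which a regular outcome has at
    least [2 ^ d - dl]. Afterwards [b] is the new position, and the former one is among [n.+1]
    vertices. *)
Lemma card_alive_hit i : (2 ^ d - dl) * #|alive_set i| <=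
  n.+1 * #|[set w in alive_set i | pos w i.+1 \in frontier w]|.
Proof.
pose P w := [rel a b | [&& w \in alive_set i, pos w i.+1 == a & b \in frontier w]].
pose Q w := [rel a b | [&& w \in alive_set i, pos w i.+1 == b & b \in frontier w]].
apply: (@leq_trans (\sum_w \sum_a \sum_b P w a b)).
  rewrite mulnC -sum_nat_const big_mkcond; apply: leq_sum => w _.
  case: ifP => // wA; rewrite (bigD1 (pos w i.+1)) //=; apply: leq_trans (leq_addr _ _).
  rewrite sum_pred.
  have -> : [set b | P w (pos w i.+1) b] = frontier w.
    by apply/setP => b; rewrite in_set /= wA eqxx.
  move: wA; rewrite in_set => /andP[_]; have := card_frontier w; rewrite /regular.
  by move=> h1 h2; rewrite leq_subLR addnC (leq_trans h1) // leq_add2l.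
apply: leq_trans (sum_swap (mm := fun w => flow_layer c w f (pos w i)) (Q := Q) _) _.
  move=> w a b /and3P[wA /eqP <- bA].
  move: wA; rewrite in_set /regular => /andP[hw hr].
  have bT : b \notin trail w i.
    apply/negP => bT; case/andP: hw => /allP/(_ _ bT) + _.
    by rewrite !in_setU bA orbT.
  have bH : b \notin bfs w d.
    apply/negP => bH; move: bA; rewrite in_set => /andP[/eqP /dtruncP].
    by case/(_ _ dstarE) => _ _ /(_ _ (ltnSn d)); rewrite bH.
  split; first exact: swap_layer.
  rewrite /Q /= in_set alive_swap // /regular deficit_swap // hr /=.
  by rewrite pos_swapS // eqxx frontier_swap.
rewrite (eq_bigr (fun w => n.+1 * ((w \in alive_set i) && (pos w i.+1 \in frontier w)))).
  rewrite -big_distrr /= sum_pred leq_mul2l; apply/orP; right.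
  by apply/subset_leq_card/subsetP => w; rewrite !in_set.
move=> w _; transitivity (\sum_(a : peer n) ((w \in alive_set i) && (pos w i.+1 \in frontier w))).
  apply: eq_bigr => a _; rewrite (bigD1 (pos w i.+1)) //= eqxx big1 ?addn0 // => b.
  by rewrite eq_sym => /negbTE ->; rewrite andbF.
by rewrite sum_nat_const card_ord.
Qed.

Definition lost_set i :=
  [set w in alive_set i | (pos w i.+1 \in doubly w d) || (pos w i.+1 \in trail w i)].

(** The step is redirected to any [b] outside the ball and the trail. The swap preserves
    [doubly w d] and the trail, so the former position is among at most [dl + i.+1] vertices: by
    [deficitS], [doubly w d] has at most [deficit w d.+1 <= dl] elements. *)
Lemma card_lost i : (n.+1 - 2 ^ d.+1 - i.+1) * #|lost_set i| <=
  (dl + i.+1) * #|outcome n|.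
Proof.
pose Z w := [set a | (a \in doubly w d) || (a \in trail w i)].
pose P w := [rel a b | [&& w \in alive_set i, pos w i.+1 == a, a \in Z w,
                        b \notin bfs w d & b \notin trail w i]].
pose Q w := [rel a b | [&& w \in alive_set i, pos w i.+1 == b & a \in Z w]].
have card_trail w : #|[set a in trail w i]| <= i.+1.
  by rewrite cardsE (leq_trans (card_size _)) // size_mkseq.
apply: (@leq_trans (\sum_w \sum_a \sum_b P w a b)).
  rewrite mulnC -sum_nat_const big_mkcond; apply: leq_sum => w _.
  case: ifP => //; rewrite in_set => /andP[wA wZ].
  rewrite (bigD1 (pos w i.+1)) //=; apply: leq_trans (leq_addr _ _).
  rewrite sum_pred.
  have -> : [set b | P w (pos w i.+1) b] = ~: (bfs w d :|: [set a in trail w i]).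
    apply/setP => b; rewrite in_setC in_setU negb_or [in RHS]in_set.
    by rewrite [LHS]in_set /= wA eqxx in_set wZ.
  have hU : #|bfs w d :|: [set a in trail w i]| <= 2 ^ d.+1 + i.+1.
    apply: leq_trans (leq_card_setU _ _) _; apply: leq_add => //.
    exact: ltnW (card_bfs w d).
  have /esym/eq_leq e := cardsC (bfs w d :|: [set a in trail w i]).
  rewrite card_ord in e; rewrite -subnDA leq_subLR; apply: leq_trans e _.
  by rewrite leq_add2r.
apply: leq_trans (sum_swap (mm := fun w => flow_layer c w f (pos w i)) (Q := Q) _) _.
  move=> w a b /and5P[wA /eqP <- aZ bH bT].
  move: wA; rewrite in_set /regular => /andP[hw hr].
  split; first exact: swap_layer.
  rewrite /Q /= in_set alive_swap // /regular deficit_swap // hr /=.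
  rewrite pos_swapS // eqxx /= in_set doubly_swap // trail_swap //.
  by move: aZ; rewrite in_set.
rewrite mulnC -sum_nat_const; apply: leq_sum => w _; rewrite exchange_big.
rewrite (bigD1 (pos w i.+1)) //= [X in _ + X]big1 ?addn0; last first.
  by move=> b; rewrite eq_sym => /negbTE bE; rewrite big1 // => a _; rewrite bE andbF.
rewrite eqxx sum_pred; case: (boolP (w \in alive_set i)) => wA /=; last first.
  apply: (@leq_trans 0) => //; rewrite leqn0 cards_eq0.
  by apply/eqP/setP => a; rewrite !in_set /= ?(negbTE wA).
apply: (@leq_trans #|doubly w d :|: [set a in trail w i]|).
  by apply/subset_leq_card/subsetP => a; rewrite in_setU !in_set.
apply: leq_trans (leq_card_setU _ _) _; apply: leq_add => //.
move: wA; rewrite in_set => /andP[_]; apply: leq_trans.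
by rewrite deficitS addnAC leq_addl.
Qed.

(** A walk that hits the frontier is no longer alive, so by [card_alive_hit] each step multiplies
    the count by at most 1 - (2^d - dl) / (n + 1). *)
Lemma card_alive k : n.+1 ^ k * #|alive_set k| <=
  (n.+1 - (2 ^ d - dl)) ^ k * #|outcome n|.
Proof.
elim: k => [|k IH]; first by rewrite !mul1n max_card.
set q := 2 ^ d - dl.
have hsub : #|alive_set k.+1| +
    #|[set w in alive_set k | pos w k.+1 \in frontier w]| <= #|alive_set k|.
  rewrite -cardsUI (_ : _ :&: _ = set0) ?cards0 ?addn0.
    apply/subset_leq_card/subsetP => w; rewrite !in_set aliveS.
    by case: (alive w k); case: (regular w); rewrite ?andbF.
  apply/setP => w; rewrite in_set0; apply/negbTE/negP; rewrite in_setI => /andP[h1 h2].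
  move: h1; rewrite in_set => /andP[+ _]; rewrite aliveS => /and3P[_ ns _].
  move: h2; rewrite in_set => /andP[_ hf].
  by move/negP: ns; apply; rewrite !in_setU hf orbT.
have hq := card_alive_hit k; rewrite -/q in hq.
have h : n.+1 * #|alive_set k.+1| <= (n.+1 - q) * #|alive_set k|.
  rewrite mulnBl leq_subRL; last first.
    apply: leq_trans hq _; rewrite leq_mul2l; apply/orP; right.
    by apply: leq_trans hsub; rewrite leq_addl.
  apply: leq_trans (leq_add hq (leqnn _)) _.
  by rewrite -mulnDr leq_mul2l addnC hsub orbT.
have {}h := leq_mul (leqnn (n.+1 ^ k)) h; rewrite mulnA -expnSr mulnCA in h.
apply: leq_trans h _; rewrite [in leqRHS]expnS -mulnA leq_mul2l.
by rewrite IH orbT.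
Qed.

Lemma walk_pos w i j : (forall k, k < j -> pos w k != source) ->
  walk (flow_graph c w f) source (pos w j) i ->
  exists2 k, k = i + j & walk (flow_graph c w f) source v0 k.
Proof.
elim: j i => [|j IH] i hs wi; first by exists i; rewrite ?addn0.
have /IH : forall k, k < j -> pos w k != source by move=> k kj; apply/hs/ltnW.
case/(_ i.+1) => [|k -> wk]; last by exists (i + j.+1); rewrite // addnS -addSn.
by apply/walkSP; exists (pos w j.+1) => //; rewrite posS flow_graph_parent ?hs.
Qed.

Definition unreached K :=
  [set w | [&& regular w, v0 \notin bfs w d.+1 &
   ~~ [exists k : 'I_(K + d.+1).+1, walk (flow_graph c w f) source v0 k]]].

(** The walk first dies either on the frontier, which yields a walk of length at most [K + d.+1]
    from the source to [v0], or in [doubly w d] or on its own trail, where it is lost. *)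
Lemma unreached_sub K :
  unreached K \subset alive_set K :|: \bigcup_(i < K) lost_set i.
Proof.
apply/subsetP => w; rewrite in_set => /and3P[hr v0N /existsPn nwalk].
rewrite in_setU in_set hr andbT; case: (boolP (alive w K)) => //= nalive.
apply/bigcupP.
have ex : exists i, ~~ alive w i by exists K.
case: (ex_minnP ex) => -[|i] ni imin.
  (* The walk starts alive: as [v0] is outside [bfs w d.+1], it is on no explored level and has no
     parent in [bfs w d]. *)
  suff h0 : v0 \notin stop w by move: ni; rewrite /alive /trail /= !andbT h0.
  rewrite !in_setU !negb_or; apply/and3P; split.
  - by apply: contra v0N; apply: in_bfs_mono.
  - by rewrite in_set (dtruncN dstarE v0N).
  - by apply: contra v0N; rewrite in_set => /forallP/(_ ord0)/parent_bfs.
have iK : i < K := imin _ nalive.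
have al j : j <= i -> alive w j.
  by move=> ji; rewrite -[alive w j]negbK; apply/negP => /imin; rewrite ltnNge ji.
have ai := al _ (leqnn i).
exists (Ordinal iK) => //=; rewrite in_set in_set ai hr /=.
move: ni; rewrite aliveS ai /= negb_and !negbK => /orP[|->]; last by rewrite orbT.
rewrite !in_setU => /orP[|/orP[|->//]].
  move=> h; have := flow_parent_notin (alive_stop ai (leqnn i)).
  by rewrite -posS h.
rewrite in_set => /andP[/eqP pk /eqP pf].
have ns k : k < i.+1 -> pos w k != source.
  move=> ki; have := alive_stop ai ki; rewrite in_setU negb_or => /andP[+ _].
  by apply: contraNneq => ->; rewrite source_bfs.
have wk := walk_main_flow dstarE pk; rewrite pf in wk.
have [k kE {}wk] := walk_pos ns wk.
have kK : k < (K + d.+1).+1 by rewrite kE ltnS addnC leq_add2r.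
by have := nwalk (Ordinal kK); rewrite wk.
Qed.

(** Union bound with denominators cleared: for N = n + 1 and q = 2^d - dl the probability of
    [unreached] is at most (1 - q / N)^K + K (dl + K) / (N - 2^(d+1) - K). *)
Lemma card_unreached K :
  (n.+1 - 2 ^ d.+1 - K) * (n.+1 ^ K * #|unreached K|) <=
  ((n.+1 - 2 ^ d.+1 - K) * (n.+1 - (2 ^ d - dl)) ^ K +
   n.+1 ^ K * (K * (dl + K))) * #|outcome n|.
Proof.
have h1 := card_alive K.
have h2 : (n.+1 - 2 ^ d.+1 - K) * #|\bigcup_(i < K) lost_set i| <=
    K * (dl + K) * #|outcome n|.
  apply: (@leq_trans (\sum_(i < K) (n.+1 - 2 ^ d.+1 - K) * #|lost_set i|)).
    rewrite -big_distrr leq_mul2l; apply/orP; right.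
    elim/big_rec2: _ => [|i s B _ hB]; first by rewrite cards0.
    by apply: leq_trans (leq_card_setU _ _) _; rewrite leq_add2l.
  rewrite -mulnA -[X in X * _]card_ord -sum_nat_const; apply: leq_sum => i _.
  apply: leq_trans (leq_trans (card_lost i) _).
    by rewrite leq_mul2r leq_sub2l ?orbT.
  by rewrite leq_mul2r leq_add2l ltn_ord orbT.
have h3 := subset_leq_card (unreached_sub K).
have {}h3 := leq_trans h3 (leq_card_setU _ _).
move: h1 h2 h3.
move: #|unreached K| #|alive_set K| #|\bigcup_(i < K) _| #|outcome n|.
move: (n.+1 ^ K) ((n.+1 - (2 ^ d - dl)) ^ K) (n.+1 - 2 ^ d.+1 - K) (K * (dl + K)).
move=> p q r s u a l o h1 h2 h3.
apply: (@leq_trans (r * (p * (a + l)))).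
  by rewrite !leq_mul2l h3 !orbT.
rewrite !mulnDr mulnDl leq_add //.
  by rewrite -mulnA leq_mul2l h1 orbT.
by rewrite mulnCA -mulnA leq_mul2l h2 orbT.
Qed.

End BackwardWalk.

(** * Dissemination *)

Section Dissemination.
Variables (R : realType) (c : R) (n : nat) (w : outcome n).
Variable gen : flow -> nat -> bool.
Implicit Types (m l : layer) (v : peer n) (f : flow).

Lemma queueS t m v : queue c w gen t.+1 (m, v) =
  behead (queue c w gen t (m, v)) ++
  [seq x <- delivered (queue c w gen t) (parent w m v) ++
            Defs.generated gen t (parent w m v) | edge_flow c w m v == Some x.1].
Proof. by []. Qed.

Lemma queue_source t m : queue c w gen t (m, source) = [::].
Proof.
elim: t => // t IH; rewrite queueS IH /=.
by rewrite /edge_flow eqxx filter_pred0.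
Qed.

Lemma queue_flow t m v x : x \in queue c w gen t (m, v) -> edge_flow c w m v = Some x.1.
Proof.
elim: t => // t IH; rewrite queueS mem_cat => /orP[/mem_behead/IH//|].
by rewrite mem_filter => /andP[/eqP].
Qed.

Lemma enum_layer : enum 'I_2 = [:: ord0; rev_ord ord0].
Proof. by apply: (inj_map val_inj); rewrite val_enum_ord. Qed.

Lemma ohead_queue_flow t m v x :
  ohead (queue c w gen t (m, v)) = Some x -> edge_flow c w m v = Some x.1.
Proof.
move=> e; apply: (@queue_flow t); move: e.
by case: (queue _ _ _ _ _) => // y s /= [->]; rewrite mem_head.
Qed.

(* Each flow enters a peer over exactly one edge, so no queue ever builds up. *)
Lemma size_queue t m v : size (queue c w gen t (m, v)) <= 1.
Proof.
elim: t m v => // t IH m v; rewrite queueS size_cat.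
have -> : behead (queue c w gen t (m, v)) = [::].
  by move: (IH m v); case: (queue _ _ _ _ _) => [|? []].
case: (edge_flow c w m v) => [f|]; last first.
  by rewrite (eq_filter (a2 := pred0)) ?filter_pred0.
rewrite add0n filter_cat size_cat /delivered /Defs.generated; set u := parent w m v.
(* The source receives nothing and generates at most one chunk of flow [f]; any other peer generates
   nothing, and receives flow [f] over one edge only. *)
case: (eqVneq u source) => [->|us].
  rewrite enum_layer /= !queue_source /= !size_filter.
  case: f => [[|[|//]] hf]; do 2!(case: (gen _ _) => //=);
  by rewrite ?eqE /= ?addn0.
rewrite addn0 enum_layer /=.
case e0 : (ohead (queue c w gen t (ord0, u))) => [x|];
case e1 : (ohead (queue c w gen t (rev_ord ord0, u))) => [y|] //=;
  do 2?case: ifP => //=.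
move=> /eqP ey /eqP ex; have := ohead_queue_flow e0; rewrite -ex.
have := ohead_queue_flow e1; rewrite -ey => h1 h0.
by have /eqP := edge_flow_inj h1 h0; rewrite (negbTE (rev_ord_neq _)).
Qed.

(** As queues hold at most one chunk, an arriving chunk is sent on in the next slot, and so advances
    by one edge per slot. *)
Lemma walk_delivered f t k v : gen f t -> walk (flow_graph c w f) source v k ->
  (f, t) \in delivered (queue c w gen (t + k)) v ++ Defs.generated gen (t + k) v.
Proof.
move=> hg; elim: k v => [|k IH] v.
  rewrite walk0 => /eqP <-; rewrite mem_cat; apply/orP; right.
  rewrite addn0 /Defs.generated eqxx; apply/mapP; exists f => //.
  by rewrite mem_filter hg mem_enum.
case/walkSP => z /IH hz /existsP[m /andP[/eqP pz /eqP ef]].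
rewrite mem_cat; apply/orP; left; rewrite /delivered mem_pmap.
apply/mapP; exists m; first by rewrite mem_enum.
rewrite addnS; have : (f, t) \in queue c w gen (t + k).+1 (m, v).
  by rewrite queueS mem_cat mem_filter ef eqxx pz hz orbT.
have := size_queue (t + k).+1 m v.
by case: (queue _ _ _ _.+1 _) => [|x [|//]] //= _; rewrite mem_seq1 => /eqP ->.
Qed.

End Dissemination.

Lemma within_good (R : realType) (c : R) n (w : outcome n) f (b : R) v k :
  v != source -> walk (flow_graph c w f) source v k -> (k%:R <= b)%R ->
  within_distance c w f b v /\ within_delay c w f b v.
Proof.
move=> vs wk kb; split.
  have [j dj jk] := dist_walk wk; exists j => //.
  by apply: le_trans kb; rewrite ler_nat.
move=> gen t hg; exists (t + k); first by rewrite natrD lerD2l.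
have := walk_delivered hg wk; rewrite mem_cat => /orP[//|].
by rewrite /Defs.generated (negbTE vs).
Qed.

(** * Mean number of bad peers *)

Section MeanBad.
Variables (R : realType) (c : R).

Definition mean_bad n (b : R) : R :=
  ((\sum_(w : outcome n) #|~: good_peers c w b|)%:R / (#|outcome n|%:R * n.+1%:R))%R.

(** All peers of an irregular outcome are counted as bad. In a regular one every peer of
    [bfs w d.+1] is counted as bad, and any other bad peer is unreached for some flow. *)
Lemma sum_bad n d K dl (b : R) : dstar c n = Posz d.+1 -> ((K + d.+1)%:R <= b)%R ->
  \sum_(w : outcome n) #|~: good_peers c w b| <=
  #|outcome n| * 2 ^ d.+2 + n.+1 * #|[set w : outcome n | ~~ regular d dl w]| +
  \sum_(f : flow) \sum_(v : peer n) #|unreached c d f v dl K|.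
Proof.
move=> dE Kb.
have -> : \sum_(f : flow) \sum_(v : peer n) #|unreached c d f v dl K| =
    \sum_(w : outcome n) \sum_(f : flow) \sum_(v : peer n) (w \in unreached c d f v dl K).
  rewrite [RHS]exchange_big; apply: eq_bigr => f _.
  rewrite [RHS]exchange_big; apply: eq_bigr => v _.
  by rewrite sum_pred; apply: eq_card => w; rewrite [RHS]in_set.
rewrite -sum_nat_const -sum_pred big_distrr -!big_split /=; apply: leq_sum => w _.
case: (boolP (regular d dl w)) => hr; last first.
  rewrite /= muln1 addnAC addnC; apply: (@leq_trans n.+1); last exact: leq_addr.
  by rewrite -[leqRHS](card_ord n.+1) max_card.
rewrite muln0 addn0 exchange_big.
apply: (@leq_trans (\sum_v ((v \in bfs w d.+1) + \sum_f (w \in unreached c d f v dl K)))).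
  rewrite -(_ : \sum_v (v \in ~: good_peers c w b) = #|~: good_peers c w b|); last first.
    by rewrite sum_pred; apply: eq_card => v; rewrite [LHS]in_set.
  apply: leq_sum => v _; case: (boolP (v \in bfs w d.+1)) => vd.
    by rewrite add1n; case: (v \in ~: _).
  rewrite add0n; case: (posnP (\sum_(f : flow) (w \in unreached c d f v dl K))) => [/eqP h0|]; last first.
    by case: (v \in ~: _).
  suff -> : v \in ~: good_peers c w b = false by [].
  apply/negbTE; rewrite in_setC negbK in_set; apply/asboolP => f.
  have vs : v != source by apply: contraNneq vd => ->; rewrite source_bfs.
  move: h0; rewrite sum_nat_eq0 => /forallP/(_ f); rewrite eqb0 in_set hr vd /= negbK.
  case/existsP => k wk; apply: (within_good vs wk); apply: le_trans Kb.
  by rewrite ler_nat -ltnS.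
rewrite big_split leq_add2r sum_pred; apply: leq_trans (ltnW (card_bfs w d.+1)).
by apply: eq_leq; apply: eq_card => v; rewrite [LHS]in_set.
Qed.

Local Open Scope ring_scope.

(** Induction on [k] for the stronger (1 - p)^k (1 + k p) <= 1. The decay 1 / (k p) is enough to
    make the probability of staying alive vanish. *)
Lemma expr_subl_bound (p : R) k : 0 <= p <= 1 -> (1 - p) ^+ k * (k%:R * p) <= 1.
Proof.
case/andP=> p0 p1; have q0 : 0 <= 1 - p by rewrite subr_ge0.
suff h : (1 - p) ^+ k * (1 + k%:R * p) <= 1.
  apply: le_trans h; rewrite ler_wpM2l ?exprn_ge0 //; lra.
elim: k => [|k IH]; first by rewrite mul0r addr0 mulr1.
apply: le_trans IH; rewrite exprSr -mulrA ler_wpM2l ?exprn_ge0 //.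
have kp : 0 <= k%:R * p by rewrite mulr_ge0.
rewrite -natr1; nra.
Qed.

Lemma mean_bad_le n d K dl (b : R) : dstar c n = Posz d.+1 -> (K + d.+1)%:R <= b ->
  (2 ^ d.+1 + K < n.+1)%N -> (dl < 2 ^ d)%N -> (0 < K)%N ->
  mean_bad n b <= 2 ^+ d.+2 / n.+1%:R +
    16 * 4 ^+ d.+1 / ((n.+1%:R - 2 ^+ d.+1) * (dl%:R + 1)) +
    2 * (n.+1%:R / (K%:R * (2 ^+ d - dl%:R)) +
         K%:R * (dl%:R + K%:R) / (n.+1%:R - 2 ^+ d.+1 - K%:R)).
Proof.
move=> dE Kb dKN dlq K0.
have hs := sum_bad dl dE Kb.
set N : R := n.+1%:R; set W : R := #|outcome n|%:R.
have W0 : 0 < W.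
  by rewrite ltr0n card_outcome_gt0.
have N0 : 0 < N by rewrite ltr0n.
have two m : (2 ^ m)%:R = 2 ^+ m :> R by rewrite natrX.
have dN : (2 ^ d.+1 < n.+1)%N by apply: leq_ltn_trans dKN; rewrite leq_addr.
have M'E : (n.+1 - 2 ^ d.+1)%:R = N - 2 ^+ d.+1 :> R by rewrite natrB ?two // ltnW.
have ME : (n.+1 - 2 ^ d.+1 - K)%:R = N - 2 ^+ d.+1 - K%:R :> R.
  by rewrite natrB ?M'E // leq_subRL ltnW.
have M'0 : 0 < N - 2 ^+ d.+1 by rewrite -M'E ltr0n subn_gt0.
have M0 : 0 < N - 2 ^+ d.+1 - K%:R by rewrite -ME ltr0n subn_gt0 ltn_subRL.
(* Markov's inequality for the deficit, which is at least [dl.+1] for irregular outcomes. *)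
have irr : #|[set w : outcome n | ~~ regular d dl w]|%:R <=
    W * (16 * 4 ^+ d.+1 / ((N - 2 ^+ d.+1) * (dl%:R + 1))).
  have h1 : (dl.+1 * #|[set w : outcome n | ~~ regular d dl w]| <=
      \sum_(w : outcome n) deficit w d.+1)%N.
    rewrite -sum_pred big_distrr /=; apply: leq_sum => w _.
    by rewrite /regular -ltnNge; case: ltnP => //=; rewrite ?muln1 ?muln0.
  have h2 := sum_deficit n (leqnn d.+1).
  have {h1 h2} := leq_trans (leq_mul (leqnn _) h1) h2.
  rewrite -(ler_nat R) !natrM M'E -/W -[dl.+1%:R]natr1 natrX => h.
  have dl0 : 0 < dl%:R + 1 :> R by rewrite natr1 ltr0n.
  rewrite mulrA ler_pdivlMr ?mulr_gt0 //.
  move: h; set I : R := #|_|%:R; set M' : R := N - _ => h.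
  have -> : I * (M' * (dl%:R + 1)) = M' * ((dl%:R + 1) * I) by ring.
  by rewrite [W * _]mulrC.
have unr (f : flow) (v : peer n) : #|unreached c d f v dl K|%:R <=
    W * (N / (K%:R * (2 ^+ d - dl%:R)) +
         K%:R * (dl%:R + K%:R) / (N - 2 ^+ d.+1 - K%:R)).
  have := card_unreached dE f v dl K.
  set q := (2 ^ d - dl)%N.
  have qE : q%:R = 2 ^+ d - dl%:R :> R by rewrite natrB ?two // ltnW.
  have q0 : 0 < q%:R :> R by rewrite ltr0n subn_gt0.
  have qN : (q <= n.+1)%N.
    apply: leq_trans (ltnW dN); apply: leq_trans (leq_subr _ _) _.
    by rewrite leq_exp2l.
  rewrite -(ler_nat R) !(natrM, natrD) ME !natrX (natrB _ qN) -/N -/W -qE.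
  set M := N - _ - _; rewrite -/M in M0; set U := #|unreached _ _ _ _ _ _|%:R => h.
  have p01 : 0 <= q%:R / N <= 1.
    apply/andP; split; first by rewrite divr_ge0 // ltW.
    by rewrite ler_pdivrMr // mul1r ler_nat.
  have K0' : 0 < K%:R :> R by rewrite ltr0n.
  have hb := expr_subl_bound K p01.
  have NqE : (N - q%:R) ^+ K = N ^+ K * (1 - q%:R / N) ^+ K.
    by rewrite -exprMn mulrBr mulr1 mulrC divfK ?gt_eqF.
  rewrite NqE in h.
  have NK0 : 0 < N ^+ K by rewrite exprn_gt0.
  have {}h : U <= W * ((1 - q%:R / N) ^+ K + K%:R * (dl%:R + K%:R) / M).
    rewrite -(ler_pM2l (mulr_gt0 M0 NK0)) -mulrA; apply: le_trans h _.
    rewrite le_eqVlt; apply/orP; left; apply/eqP.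
    by field; rewrite gt_eqF.
  apply: le_trans h _; rewrite ler_pM2l // lerD2r.
  rewrite ler_pdivlMr ?mulr_gt0 //.
  by move: hb; rewrite 2!mulrA ler_pdivrMr // mul1r mulrA.
rewrite /mean_bad -/W -/N ler_pdivrMr ?mulr_gt0 //.
apply: (@le_trans _ _ (W * 2 ^+ d.+2 + N * #|[set w : outcome n | ~~ regular d dl w]|%:R +
   \sum_(f < 2) \sum_(v < n.+1) #|unreached c d f v dl K|%:R)).
  rewrite -natrX -!natrM -natrD.
  rewrite (eq_bigr (fun f => (\sum_(v < n.+1) #|unreached c d f v dl K|)%:R)); last first.
    by move=> f _; rewrite natr_sum.
  by rewrite -natr_sum -natrD ler_nat.
apply: (@le_trans _ _ (W * 2 ^+ d.+2 +
   N * (W * (16 * 4 ^+ d.+1 / ((N - 2 ^+ d.+1) * (dl%:R + 1)))) +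
   2 * N * (W * (N / (K%:R * (2 ^+ d - dl%:R)) +
         K%:R * (dl%:R + K%:R) / (N - 2 ^+ d.+1 - K%:R))))).
  rewrite lerD //; first by rewrite lerD // ler_pM2l.
  apply: le_trans (ler_sum _ (fun f _ => ler_sum _ (fun v _ => unr f v))) _.
  set Y := W * _; rewrite (sumr_const _ Y) card_ord -[Y *+ _]mulr_natl -/N.
  by rewrite big_ord_recl big_ord1 -mulrA mulr_natl.
set X := 16 * _ / _; set Y := _ / _ + _ / _.
rewrite le_eqVlt; apply/orP; left; apply/eqP; field.
by rewrite gt_eqF.
Qed.

End MeanBad.

(** * Choice of scales and asymptotics *)

Section Asymptotics.
Variables (R : realType) (c : R).
Local Open Scope classical_set_scope.
Local Open Scope ring_scope.

(* Used with A = log^c N, B = log^(3c/4) N and z = log^eps N; N / A is the scale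
   of P = 2^d, D is the deficit allowed and K the number of backward steps. *)
Lemma scale_estimate (N P A B z L K D : R) :
  0 < N -> 16 <= z -> z * z <= B -> B * z <= A -> A * z <= L -> L ^+ 3 <= 27 * N ->
  N / A <= P -> P < 2 * (N / A) -> 0 <= D -> D <= N / A / B -> N / A / B < D + 1 ->
  0 <= K -> K <= A * z -> A * z < K + 1 ->
  [/\ P + K < N, D < P / 2, 0 < K &
    2 * P / N + 16 * (P * P) / ((N - P) * (D + 1)) +
    2 * (N / (K * (P / 2 - D)) + K * (D + K) / (N - P - K)) <= 372 / z].
Proof.
move=> N0 z16 zB BA AL L3 + + D0 + + K0 KA AK.
have z0 : 0 < z by lra.
have le16 u v : 0 <= u -> u * z <= v -> 16 * u <= v.
  by move=> u0; apply: le_trans; rewrite mulrC ler_wpM2l.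
have zB16 : 16 * z <= B by apply: le16 zB; exact: ltW.
have B0 : 0 < B by lra.
have BA16 : 16 * B <= A by apply: le16 BA; exact: ltW.
have A0 : 0 < A by lra.
have AL16 : 16 * A <= L by apply: le16 AL; exact: ltW.
have L0 : 0 < L by lra.
have zA : z <= A by lra.
have zL : z <= L by lra.
have L20 : 20 <= L by lra.
have K2 : A * z / 2 <= K by have := le16 A (A * z) (ltW A0) (lexx _); lra.
have {}K0 : 0 < K.
  by apply: lt_le_trans K2; rewrite divr_gt0 // mulr_gt0.
have KL : K <= L by apply: le_trans AL.
have L2 : L ^+ 2 <= 27 * (N / L).
  by rewrite mulrA ler_pdivlMr // -exprSr.
have LN : L <= N / 4.
  suff : L * 400 <= 27 * N by lra.
  apply: le_trans L3; rewrite exprSr [leRHS]mulrC; apply: ler_wpM2l; first exact: ltW.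
  have -> : 400 = 20 * 20 :> R by lra.
  by rewrite expr2; apply: ler_pM; lra.
clear L3 AK.
set x := N / A; set y := x / B => xP Px Dy yD.
have x0 : 0 < x by rewrite divr_gt0.
have y0 : 0 < y by rewrite divr_gt0.
have xA : x * A = N by rewrite /x divfK // gt_eqF.
have yB : y * B = x by rewrite /y divfK // gt_eqF.
have N2 : 2 * x <= N / 2.
  suff : x * 4 <= x * A by rewrite xA; lra.
  by apply: ler_wpM2l; [exact: ltW|lra].
have y4 : 4 * y <= x.
  suff : y * 4 <= y * B by rewrite yB; lra.
  by apply: ler_wpM2l; [exact: ltW|lra].
have xz : x * z <= N by rewrite -xA; apply: ler_wpM2l => //; exact: ltW.
have h1 : N / 4 <= N - P - K by lra.
have h2 : N / 2 <= N - P by lra.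
have h3 : x / 4 <= P / 2 - D by lra.
have P0 : 0 < P by lra.
clearbody x y.
split; [lra|lra|by []|].
(* Since P < 2 x and x / N = 1 / A, this term is at most 4 / A. *)
have T1 : 2 * P / N <= 4 / z.
  rewrite ler_pdivrMr // [leRHS]mulrAC ler_pdivlMr //.
  have : P * z <= 2 * x * z by apply: ler_wpM2r; exact: ltW.
  clear - xz; lra.
(* With P < 2 x, N - P >= N / 2 and D + 1 > y the term is at most 128 B / A, as x / y = B and x / N
   = 1 / A. *)
have T2 : 16 * (P * P) / ((N - P) * (D + 1)) <= 128 / z.
  have e1 : N / 2 * y <= (N - P) * (D + 1).
    by apply: ler_pM => //; [rewrite divr_ge0 // ltW|exact: ltW|exact: ltW].
  have e2 : P * P <= (2 * x) * (2 * x) by apply: ler_pM; exact: ltW.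
  have e3 : 0 < N / 2 * y by rewrite mulr_gt0 // divr_gt0.
  rewrite ler_pdivrMr; last by apply: lt_le_trans e1.
  apply: (@le_trans _ _ (64 * (x * x))); first by clear - e2; lra.
  apply: (@le_trans _ _ (128 / z * (N / 2 * y))); last first.
    by rewrite ler_wpM2l // divr_ge0 // ltW.
  rewrite [leRHS]mulrAC ler_pdivlMr //.
  have -> : 128 * (N / 2 * y) = 64 * (x * y) * A by rewrite -xA; field.
  have -> : 64 * (x * x) * z = 64 * (x * y) * (B * z) by rewrite -{2}yB; ring.
  by rewrite ler_wpM2l // !mulr_ge0 // ltW.
(* Here K >= A z / 2 and P / 2 - D >= x / 4, where x A = N. *)
have T3 : N / (K * (P / 2 - D)) <= 8 / z.
  have e1 : A * z / 2 * (x / 4) <= K * (P / 2 - D).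
    by apply: ler_pM => //; rewrite divr_ge0 // ?mulr_ge0 // ltW.
  have e3 : 0 < A * z / 2 * (x / 4) by rewrite !(mulr_gt0, divr_gt0).
  rewrite ler_pdivrMr; last by apply: lt_le_trans e1.
  apply: (@le_trans _ _ (8 / z * (A * z / 2 * (x / 4)))); last first.
    by rewrite ler_wpM2l // divr_ge0 // ltW.
  rewrite -xA le_eqVlt; apply/orP; left; apply/eqP; field.
  by rewrite gt_eqF.
(* K D <= A z y = N z / B <= N / z, K^2 <= L^2 <= 27 N / L <= 27 N / z, and the denominator is at
   least N / 4; 112 is 4 (1 + 27). *)
have T4 : K * (D + K) / (N - P - K) <= 112 / z.
  rewrite ler_pdivrMr; last by apply: lt_le_trans h1; rewrite divr_gt0.
  apply: (@le_trans _ _ (112 / z * (N / 4))); last first.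
    by rewrite ler_wpM2l // divr_ge0 // ltW.
  have e2 : K * D <= N / z.
    rewrite ler_pdivlMr //; apply: (@le_trans _ _ (A * z * y * z)).
      by apply: ler_wpM2r; [exact: ltW|apply: ler_pM => //; exact: ltW].
    have -> : A * z * y * z = A * y * (z * z) by ring.
    apply: (@le_trans _ _ (A * y * B)).
      by apply: ler_wpM2l => //; apply: mulr_ge0; exact: ltW.
    by rewrite -mulrA yB mulrC xA.
  have e3 : K * K <= 27 * (N / z).
    apply: (@le_trans _ _ (L ^+ 2)).
      by rewrite expr2; apply: ler_pM => //; exact: ltW.
    apply: le_trans L2 _; apply: ler_wpM2l => //; apply: ler_wpM2l; first exact: ltW.
    by rewrite lef_pV2 // posrE.
  have -> : 112 / z * (N / 4) = N / z + 27 * (N / z) by field; rewrite gt_eqF.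
  by rewrite mulrDr lerD.
have -> : 372 / z = 4 / z + 128 / z + 2 * (8 / z + 112 / z) by field; rewrite gt_eqF.
by apply: lerD; [exact: lerD|rewrite ler_wpM2l // lerD].
Qed.

Lemma mean_bad_scale n d K dl (b A B z L : R) :
  dstar c n = Posz d.+1 -> (K + d.+1)%:R <= b ->
  16 <= z -> z * z <= B -> B * z <= A -> A * z <= L -> L ^+ 3 <= 27 * n.+1%:R ->
  n.+1%:R / A <= 2 ^+ d.+1 -> 2 ^+ d.+1 < 2 * (n.+1%:R / A) ->
  dl%:R <= n.+1%:R / A / B -> n.+1%:R / A / B < dl%:R + 1 ->
  K%:R <= A * z -> A * z < K%:R + 1 ->
  mean_bad c n b <= 372 / z.
Proof.
move=> dE Kb z16 zB BA AL L3 xP Px dly ydl KA AK.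
have N0 : 0 < n.+1%:R :> R by rewrite ltr0n.
have [] := scale_estimate N0 z16 zB BA AL L3 xP Px (ler0n R dl) dly ydl (ler0n R K) KA AK.
have PE2 : 2 ^+ d.+2 = 2 * 2 ^+ d.+1 :> R by rewrite exprS.
have PEh : 2 ^+ d = 2 ^+ d.+1 / 2 :> R.
  by rewrite exprSr mulfK // pnatr_eq0.
have PE4 : 4 ^+ d.+1 = 2 ^+ d.+1 * 2 ^+ d.+1 :> R.
  by rewrite -exprMn -natrM.
rewrite -PE2 -PE4 -PEh => c1 c2 c3; apply: le_trans; apply: mean_bad_le => //.
- by rewrite -(ltr_nat R) natrD natrX.
- by rewrite -(ltr_nat R) natrX.
- by rewrite -(ltr_nat R).
Qed.

Hypothesis c01 : 0 < c < 1.

Lemma ln2_ge : 1 / 2 <= ln 2 :> R.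
Proof.
have /le_ln1Dx : -1 < - (1 / 2) :> R by lra.
have -> : 1 + - (1 / 2) = 2^-1 :> R by field.
by rewrite lnV ?posrE //; lra.
Qed.

(** As [1 < x], the ceiling d^* is positive and has the form [d.+1]; the bounds come from r <= d^* <
    r + 1 with r = ln x / ln 2. *)
Lemma dstar_bounds n (x : R) : x = n.+1%:R / (ln n.+1%:R `^ c) -> 1 < x ->
  exists d, [/\ dstar c n = Posz d.+1, x <= 2 ^+ d.+1, 2 ^+ d.+1 < 2 * x &
               d.+1%:R < ln x / ln 2 + 1].
Proof.
move=> xE x1; have l2 := ln2_ge; have l20 : 0 < ln 2 :> R by lra.
have x0 : 0 < x by lra.
rewrite /dstar -xE; set r := ln x / ln 2.
have r0 : 0 < r by rewrite divr_gt0 // ln_gt0.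
have l2N : ln 2 != 0 :> R by rewrite gt_eqF.
have /andP[rlt rle] := ceil_itv r.
have cpos : 0 < Num.ceil r by rewrite -(ltr0z R); apply: lt_le_trans rle.
case cE : (Num.ceil r) cpos rlt rle => [[//|d]|//] _ rlt rle.
have {}rle : r <= d.+1%:R by [].
have {}rlt : d.+1%:R < r + 1.
  by move: rlt; rewrite intrB -[(Posz d.+1)%:~R]/(d.+1%:R) ltrBlDr.
have lx : ln x = r * ln 2 by rewrite /r divfK.
have lP : ln (2 ^+ d.+1) = d.+1%:R * ln 2 :> R by rewrite lnXn // mulr_natl.
have P0 : 0 < 2 ^+ d.+1 :> R by rewrite exprn_gt0.
exists d; split=> //.
- by rewrite -ler_ln ?posrE // lx lP ler_wpM2r // ltW.
- rewrite -ltr_ln ?posrE // ?mulr_gt0 // lnM ?posrE // lx lP.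
  by rewrite -[X in _ < X + _]mul1r -mulrDl ltr_pM2r // addrC.
Qed.

Lemma mean_bad_eventually (Z : R) : 16 <= Z ->
  \forall n \near \oo, mean_bad c n (4 * ln n.+1%:R) <= 372 / Z.
Proof.
move=> Z16; have Z0 : 0 < Z by lra.
have [c0 c1] := andP c01.
(* The exponents must satisfy 2 eps <= 3c/4, 3c/4 + eps <= c and c + eps <= 1. *)
pose eps := c * (1 - c) / 4.
have c1' : 0 < 1 - c by lra.
have e0 : 0 < eps by rewrite divr_gt0 // mulr_gt0.
have ec : eps <= c / 4.
  by rewrite /eps ler_pM2r ?invr_gt0 // ler_piMr // ?ltW //; lra.
have ec1 : eps <= (1 - c) / 4.
  by rewrite /eps ler_pM2r ?invr_gt0 // ler_piMl // ltW.
near=> n.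
set N : R := n.+1%:R; set L := ln N.
have N0 : 0 < N by rewrite ltr0n.
(* For large [n] this gives both L >= 1 and z = L^eps >= Z. *)
have LZ : 1 + Z `^ eps^-1 <= L.
  have : expR (1 + Z `^ eps^-1) <= N.
    apply: le_trans (ltW (truncnS_gt _)) _.
    rewrite ler_nat ltnS; near: n; exact: nbhs_infty_ge.
  by move=> h; rewrite -ler_expR /L lnK ?posrE.
have L1 : 1 <= L by apply: le_trans LZ; rewrite lerDl powR_ge0.
have L0 : 0 < L by lra.
have NE : N = expR L by rewrite /L lnK ?posrE.
pose z := L `^ eps; pose A := L `^ c; pose B := L `^ (3 / 4 * c).
have zZ : Z <= z.
  have -> : Z = (Z `^ eps^-1) `^ eps.
    by rewrite -powRrM mulVf ?gt_eqF // powRr1 // ltW.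
  apply: ge0_ler_powR; [exact: ltW|by rewrite nnegrE powR_ge0| |].
    by rewrite nnegrE ltW.
  by apply: le_trans LZ; rewrite lerDr.
have pD r s : L `^ r * L `^ s = L `^ (r + s).
  by rewrite powRD // (gt_eqF L0) implybT.
have zB : z * z <= B by rewrite pD; apply: ler_powR => //; lra.
have BA : B * z <= A by rewrite pD; apply: ler_powR => //; lra.
have AL : A * z <= L.
  rewrite pD; apply: (@le_trans _ _ (L `^ 1)); last by rewrite powRr1 // ltW.
  by apply: ler_powR => //; lra.
(* Cube of L <= 3 e^(L/3), where e^L = N. *)
have L3 : L ^+ 3 <= 27 * N.
  have h : 1 + L / 3 <= expR (L / 3) by exact: expR_ge1Dx.
  have -> : 27 * N = (3 * expR (L / 3)) ^+ 3.
    rewrite exprMn -expRM_natl NE; congr (_ * expR _); first by lra.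
    by field.
  by rewrite lerXn2r ?nnegrE ?mulr_ge0 ?expR_ge0 //; lra.
have A0 : 0 < A by rewrite powR_gt0.
have z16 : 16 <= z by lra.
have B0 : 0 < B by rewrite powR_gt0.
have B16 : 16 * 16 <= B by apply: le_trans zB; apply: ler_pM.
have leBA : B <= A.
  by apply: le_trans BA; rewrite -[leLHS]mulr1; apply: ler_wpM2l; [exact: ltW|lra].
have leAL : A <= L.
  by apply: le_trans AL; rewrite -[leLHS]mulr1; apply: ler_wpM2l; [exact: ltW|lra].
have A1 : 1 < N / A.
  have L2 : 27 <= L by lra.
  have AL' : A < L.
    apply: lt_le_trans AL; rewrite -[ltLHS]mulr1 ltr_pM2l //; lra.
  rewrite ltr_pdivlMr // mul1r; apply: lt_le_trans AL' _.
  suff : L * 27 <= 27 * N by lra.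
  apply: le_trans L3; rewrite exprSr [leRHS]mulrC; apply: ler_wpM2l; first exact: ltW.
  apply: (@le_trans _ _ (L * 1)); first by rewrite mulr1.
  by rewrite expr2; apply: ler_wpM2l; [exact: ltW|].
have [d [dE xP Px dL]] := dstar_bounds erefl A1.
pose K := Num.trunc (A * z); pose dl := Num.trunc (N / A / B).
have /andP[KA AK] : K%:R <= A * z < K.+1%:R.
  by apply: truncn_itv; rewrite mulr_ge0 // ltW // (lt_le_trans _ z16).
have /andP[dly ydl] : dl%:R <= N / A / B < dl.+1%:R.
  by apply: truncn_itv; rewrite !divr_ge0 // ltW.
(* Origin of the constant 4: K <= A z <= L, and d + 1 <= 2 L + 1 <= 3 L since ln 2 >= 1/2. *)
have Kb : (K + d.+1)%:R <= 4 * L.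
  have l2 := ln2_ge.
  have : ln (N / A) / ln 2 <= 2 * L.
    have lx : ln (N / A) <= L.
      rewrite /L ler_ln ?posrE ?divr_gt0 // ler_pdivrMr // ler_peMr ?ltW //; lra.
    rewrite ler_pdivrMr; last lra.
    have := ler_wpM2l (ltW L0) l2; lra.
  rewrite natrD; lra.
apply: le_trans (mean_bad_scale dE Kb z16 zB BA AL L3 xP Px dly _ KA _) _.
- by rewrite natr1.
- by rewrite natr1.
- by rewrite ler_wpM2l // lef_pV2 ?posrE //; lra.
Unshelve. all: by end_near.
Qed.

End Asymptotics.

Local Open Scope classical_set_scope.
Local Open Scope ring_scope.

(** * Markov's inequality and the limit *)

Section Markov.
Variables (R : realType) (c : R).

(** The square root balances Markov's inequality: the same rate bounds the allowed fraction of bad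
    peers and the probability of exceeding it. The term 1/N makes the rate positive, so that it can
    be divided by. *)
Definition bad_rate n : R :=
  Num.sqrt (mean_bad c n (4 * ln n.+1%:R)) + n.+1%:R^-1.

Lemma mean_bad_ge0 n b : 0 <= mean_bad c n b.
Proof. by rewrite divr_ge0 // mulr_ge0. Qed.

Lemma bad_rate_gt0 n : 0 < bad_rate n.
Proof. by rewrite ltr_wpDl ?sqrtr_ge0 // invr_gt0. Qed.

Lemma uniform_pr_good n (r := bad_rate n) :
  1 - r <= uniform_pr R [set w : outcome n |
    (1 - r) * n.+1%:R <= #|good_peers c w (4 * ln n.+1%:R)|%:R]%SET <= 1.
Proof.
set b := 4 * ln _; set G := [set w | _]%SET.
have W0 : 0 < #|outcome n|%:R :> R by rewrite ltr0n card_outcome_gt0.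
have r0 : 0 < r := bad_rate_gt0 n.
have N0 : 0 < n.+1%:R :> R by [].
apply/andP; split; rewrite /uniform_pr; last first.
  by rewrite ler_pdivrMr // mul1r ler_nat max_card.
have GE : #|G|%:R = #|outcome n|%:R - #|~: G|%:R :> R.
  by rewrite -(cardsC G) natrD addrK.
rewrite GE mulrBl divff ?gt_eqF // lerD2l lerN2 ler_pdivrMr //.
have markov : #|~: G|%:R * (r * n.+1%:R) <= mean_bad c n b * (#|outcome n|%:R * n.+1%:R).
  rewrite /mean_bad divfK ?mulf_neq0 ?gt_eqF // natr_sum -sum1_card natr_sum mulr_suml.
  rewrite big_mkcond; apply: ler_sum => w _; case: ifP => //.
  rewrite in_setC in_set -ltNge mul1r => h.
  have : #|good_peers c w b|%:R + #|~: good_peers c w b|%:R = n.+1%:R :> R.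
    by rewrite -natrD cardsC card_ord.
  move: h; rewrite -/b; lra.
have mr : mean_bad c n b <= r * r.
  rewrite -[leLHS]sqr_sqrtr ?mean_bad_ge0 // expr2.
  by apply: ler_pM; rewrite ?sqrtr_ge0 // lerDl invr_ge0 ltW.
have rN0 : 0 < r * n.+1%:R by rewrite mulr_gt0.
rewrite -(ler_pM2r rN0); apply: le_trans markov _.
have -> : r * #|outcome n|%:R * (r * n.+1%:R) = r * r * (#|outcome n|%:R * n.+1%:R) by ring.
by apply: ler_wpM2r => //; rewrite mulr_ge0.
Qed.

Hypothesis c01 : 0 < c < 1.

Lemma bad_rate_cvg : bad_rate n @[n --> \oo] --> 0.
Proof.
rewrite -[0]addr0; apply: cvgD; last exact: cvg_harmonic.
apply/cvgrPdist_le => e e0.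
(* This value Z satisfies both Z >= 16 and 372 / Z <= e^2. *)
have Z0 : 0 < Num.max 16 (372 / e ^+ 2) by rewrite lt_max ltr0n.
have Z16 : 16 <= Num.max 16 (372 / e ^+ 2) by rewrite le_max lexx.
have := mean_bad_eventually c01 Z16; apply: filterS => n h.
rewrite sub0r normrN ger0_norm ?sqrtr_ge0 //.
apply: (@le_trans _ _ (Num.sqrt (e ^+ 2))); last by rewrite sqrtr_sqr ger0_norm // ltW.
apply: ler_wsqrtr.
apply: le_trans h _; rewrite ler_pdivrMr // mulrC -ler_pdivrMr ?exprn_gt0 //.
by rewrite le_max lexx orbT.
Qed.

End Markov.

Theorem mainTheorem1 (R : realType) (c : R) (hc : 0 < c < 1) :
  exists (C : R) (delta : nat -> R),
    [/\ 0 < C,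
        delta N @[N --> \oo] --> 0 &
        uniform_pr R [set w : outcome n |
            (1 - delta n.+1) * n.+1%:R
              <= #|good_peers c w (C * ln n.+1%:R)|%:R]%SET
          @[n --> \oo] --> (1 : R)].
Proof.
have cvg_rate := bad_rate_cvg hc.
(* [delta] is indexed by the number N of peers, [bad_rate] by n = N - 1. *)
exists 4, (fun N => bad_rate c N.-1); split => //.
  by rewrite -cvg_shiftS.
apply: (@squeeze_cvgr _ _ _ _ (fun n => 1 - bad_rate c n) (fun=> 1)).
- by apply: nearW => n; exact: uniform_pr_good.
- by rewrite -[X in _ --> X]subr0; apply: cvgB => //; exact: cvg_cst.
- exact: cvg_cst.
Qed.
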